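(* On the Lie algebra $\mathfrak n_3\oplus\mathbb R$ (with $\mathfrak n_3$ the 3-dimensional Heisenberg algebra), the only non-classical generalized nilsolitons are the following: (1) $\mu(e_1,e_2)=e_3$, $H=e^{123}$, $\lambda=-2$, $D=\operatorname{diag}(1,1,2,2)$; (2) $\mu(e_1,e_2)=e_3$, $H=\lambda_1e^{234}+\lambda_2e^{134}$, $\lambda_1^2+\lambda_2^2=1$, $\lambda=-\frac32$, $D=\operatorname{diag}\left(1-\frac{\lambda_2^2}2,\,1-\frac{\lambda_1^2}2,\,\frac32,\,1\right)$. In particular, the first one is the unique algebraic pluriclosed soliton on $\mathfrak n_3\oplus\mathbb R$.
   Context: Data $(\mu,g,H)$ consist of a Lie bracket $\mu$ on a finite-dimensional real vector space $\mathfrak g$, an inner product $g$ on $\mathfrak g$, and a 3-form $H\in\Lambda^3\mathfrak g^*$ with $\mathrm d_\mu H=0$ (Chevalley–Eilenberg differential); they encode a left-invariant exact Courant algebroid over the simply connected Lie group of $(\mathfrak g,\mu)$ with a left-invariant generalized metric. For $\mu$ nilpotent, they form a generalized nilsoliton if there exist $\lambda\in\mathbb R$ and $D\in\operatorname{Der}(\mathfrak g,\mu)$ with $$\operatorname{Ric}^B_{\mu,H}=\lambda\operatorname{Id}+D,\qquad\Delta_\mu H=\lambda H+\rho(\operatorname{Ric}^B_{\mu,H})H .$$ Here $\operatorname{Ric}^B_{\mu,H}=\operatorname{Ric}_\mu-\frac14g^{-1}H^2$, $\operatorname{Ric}_\mu$ is the Ricci endomorphism of the left-invariant metric $g$, $H^2(X,Y)=\sum_{i,j}H(X,e_i,e_j)H(Y,e_i,e_j)$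 in an orthonormal basis, $\Delta_\mu H=-\mathrm d_\mu\mathrm d_\mu^*H$ with $\mathrm d_\mu^*$ the usual codifferential, and $(\rho(A)H)(X,Y,Z)=-H(AX,Y,Z)-H(X,AY,Z)-H(X,Y,AZ)$. The nilsoliton is non-classical if $H\ne0$. In the list, $\{e_1,e_2,e_3,e_4\}$ is an orthonormal basis, unlisted brackets vanish, $e^{ijk}=e^i\wedge e^j\wedge e^k$, and $\lambda,D$ are the constant and derivation in the soliton equations. The classification is up to scaling (replacing $(g,H)$ by $(cg,cH)$, $c>0$, which corresponds to rescaling the neutral inner product of the Courant algebroid) and up to generalized automorphisms of the exact Courant algebroid under consideration, i.e. maps $\begin{pmatrix}A&0\\0&(A^{-1})^*\end{pmatrix}\begin{pmatrix}\mathrm{Id}&0\\ b&\mathrm{Id}\end{pmatrix}$ of $\mathfrak g\oplus\mathfrak g^*$ with $A\in\operatorname{Aut}(\mathfrak g,\mu)$, $b\in\Lambda^2\mathfrak g^*$ and $H(A\cdot,A\cdot,A\cdot)=H-\mathrm d_\mu b$. A left-invariant SKT structure $(J,g)$: $J$ a left-invariant integrable complex structure orthogonal for $g$, with $\omega=g(J\cdot,\cdot)$ satisfying $\mathrm d\mathrm d^c\omega=0$, $\mathrm d^c=J^{-1}\mathrm dJ$. It is an algebraic pluriclosed soliton if there are $D\in\operatorname{Der}(\mathfrak g)$ commuting with $J$ and $\lambda\in\mathbb R$ with $P=\lambda\operatorname{Id}+\frac12(D+D^t)$, where $P\in\operatorname{End}(\mathfrak g)$ is defined by $\omega(P\cdot,\cdot)=(\rho^B)^{1,1}$,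 the $(1,1)$-part of the Bismut–Ricci form. A generalized nilsoliton $(\mu,g,H)$ is regarded as an algebraic pluriclosed soliton when there is such a $J$ with $(J,g)$ an algebraic pluriclosed soliton and $H=\mathrm d^c\omega$.
   Formalization: The list as printed is mended twice: H = -e^{123} (same λ, D) is also a nilsoliton, inequivalent to (1), and is added; in (2), D gets the off-diagonal e_1,e_2 entries -λ_1λ_2/2, since H^2(e_1,e_2) = 2λ_1λ_2, so the printed diagonal D fails if λ_1λ_2 ≠ 0. *)

(* Defs.v *)
From HB Require Import structures.
From mathcomp Require Import all_boot all_order all_algebra.
From mathcomp Require Import reals.

Set Implicit Arguments.
Unset Strict Implicit.
Unset Printing Implicit Defensive.

Import Order.TTheory GRing.Theory Num.Theory.
Local Open Scope ring_scope.

Section LieAlgebras.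
Context {R : realType}.

Definition lie_bracket (V : vectType R) (mu : V -> V -> V) : Prop :=
  [/\ bilinear_for *:%R *:%R mu,
      forall X, mu X X = 0 &
      forall X Y Z, mu X (mu Y Z) + mu Y (mu Z X) + mu Z (mu X Y) = 0].

Definition lie_nilpotent (V : vectType R) (mu : V -> V -> V) : Prop :=
  exists k : nat, forall (s : seq V) (X : V), size s = k -> foldr mu X s = 0.

Definition derivation (V : vectType R) (mu : V -> V -> V) (D : 'End(V)) : Prop :=
  forall X Y, D (mu X Y) = mu (D X) Y + mu X (D Y).

Definition lie_isomorphic (V W : vectType R)
    (mu : V -> V -> V) (nu : W -> W -> W) : Prop :=
  exists f : 'Hom(V, W),
    [/\ lker f = 0%VS, limg f = fullv &
        forall X Y, f (mu X Y) = nu (f X) (f Y)].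

Definition lie_automorphism (V : vectType R) (mu : V -> V -> V)
    (A : 'End(V)) : Prop :=
  lker A = 0%VS /\ forall X Y, A (mu X Y) = mu (A X) (A Y).

(* (x, y) |-> (0, 0, x_1 y_2 - x_2 y_1), with 0-based indices in 'I_3. *)
Definition n3_bracket (x y : 'rV[R]_3) : 'rV[R]_3 :=
  (x 0 0 * y 0 1 - x 0 1 * y 0 0) *: delta_mx 0 ord_max.

Definition abelian_bracket (V : vectType R) (_ _ : V) : V := 0.

Definition direct_sum_bracket (V W : vectType R)
    (mu : V -> V -> V) (nu : W -> W -> W) (x y : V * W) : V * W :=
  (mu x.1 y.1, nu x.2 y.2).

Definition n3R_bracket : 'rV[R]_3 * R^o -> 'rV[R]_3 * R^o -> 'rV[R]_3 * R^o :=
  direct_sum_bracket n3_bracket (@abelian_bracket R^o).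

End LieAlgebras.

Section Geometry.
Context {R : realType} {V : vectType R}.
Implicit Types (mu : V -> V -> V) (g b : V -> V -> R) (H : V -> V -> V -> R).
Implicit Types (nab : V -> V -> V) (A D J P : 'End(V)) (e : seq V).

Definition inner_product g : Prop :=
  [/\ bilinear_for *%R *%R g, forall X Y, g X Y = g Y X &
      forall X, X != 0 -> 0 < g X X].

Definition two_form b : Prop :=
  bilinear_for *%R *%R b /\ forall X, b X X = 0.

Definition three_form H : Prop :=
  [/\ forall Y Z, scalar (fun X => H X Y Z),
      forall X Z, scalar (fun Y => H X Y Z),
      forall X Y, scalar (fun Z => H X Y Z),
      forall X Z, H X X Z = 0 &
      forall X Z, H X Z Z = 0].

(* Chevalley-Eilenberg differential: the sum over i < j of
   (-1)^(i+j) alpha ([X_i, X_j], the other arguments in order). *)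
Definition d2 mu b : V -> V -> V -> R := fun X Y Z =>
  - b (mu X Y) Z + b (mu X Z) Y - b (mu Y Z) X.

Definition d3 mu H : V -> V -> V -> V -> R := fun X Y Z W =>
  - H (mu X Y) Z W + H (mu X Z) Y W - H (mu X W) Y Z
  - H (mu Y Z) X W + H (mu Y W) X Z - H (mu Z W) X Y.

Definition orthonormal_basis g e : Prop :=
  basis_of fullv e /\
  forall i j, (i < size e)%N -> (j < size e)%N -> g e`_i e`_j = (i == j)%:R.

(* In the definitions below e is a g-orthonormal basis; the result does not
   depend on its choice. *)

(* The g-dual vector of a linear form. *)
Definition sharp e (phi : V -> R) : V := \sum_(u <- e) phi u *: u.

(* Levi-Civita connection on left-invariant fields, by the Koszul formula. *)
Definition levi_civita mu g e : V -> V -> V := fun X Y =>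
  sharp e (fun Z => 2^-1 * (g (mu X Y) Z - g (mu Y Z) X + g (mu Z X) Y)).

Definition curvature mu nab : V -> V -> V -> V := fun X Y Z =>
  nab X (nab Y Z) - nab Y (nab X Z) - nab (mu X Y) Z.

Definition ricci_form mu g e : V -> V -> R := fun X Y =>
  \sum_(u <- e) g (curvature mu (levi_civita mu g e) u X Y) u.

Definition ricci mu g e (X : V) : V := sharp e (ricci_form mu g e X).

Definition H_square e H : V -> V -> R := fun X Y =>
  \sum_(u <- e) \sum_(v <- e) H X u v * H Y u v.

Definition ricci_B mu g e H (X : V) : V :=
  ricci mu g e X - 4^-1 *: sharp e (H_square e H X).

Definition nabla3 nab (T : V) H : V -> V -> V -> R := fun X Y Z =>
  - H (nab T X) Y Z - H X (nab T Y) Z - H X Y (nab T Z).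

Definition codiff3 mu g e H : V -> V -> R := fun X Y =>
  - \sum_(u <- e) nabla3 (levi_civita mu g e) u H u X Y.

Definition laplacian mu g e H : V -> V -> V -> R := fun X Y Z =>
  - d2 mu (codiff3 mu g e H) X Y Z.

Definition rho (A : V -> V) H : V -> V -> V -> R := fun X Y Z =>
  - H (A X) Y Z - H X (A Y) Z - H X Y (A Z).

Definition soliton_data mu g H : Prop :=
  [/\ lie_bracket mu, inner_product g, three_form H &
      forall X Y Z W, d3 mu H X Y Z W = 0].

Definition generalized_nilsoliton mu g H (lam : R) D : Prop :=
  [/\ soliton_data mu g H, lie_nilpotent mu, derivation mu D &
      exists e, [/\ orthonormal_basis g e,
        forall X, ricci_B mu g e H X = lam *: X + D X &
        forall X Y Z, laplacian mu g e H X Y Z =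
                      lam * H X Y Z + rho (ricci_B mu g e H) H X Y Z]].

Definition non_classical H : Prop := ~ (forall X Y Z, H X Y Z = 0).

(* The map diag(A, (A^-1)^* ) (Id 0; b Id) is an automorphism of the exact
   Courant algebroid g + g^* twisted by H. *)
Definition generalized_automorphism mu H A b : Prop :=
  [/\ lie_automorphism mu A, two_form b &
      forall X Y Z, H (A X) (A Y) (A Z) = H X Y Z - d2 mu b X Y Z].

(* Equivalence up to scaling and generalized automorphisms.  On the Courant
   algebroid twisted by cH, the automorphism (A, b) maps the generalized metric
   {X + c g X} to {Y + (g' + b') Y}, with g' and b' the push-forwards by A of
   cg and b.  In the isotropic splitting Y |-> Y + b' Y this is the metric g'
   with the 3-form H' = cH + d b', which is the push-forward of cH by A since
   (A, b) is an automorphism. *)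
Definition generalized_equivalent mu g H g' H' : Prop :=
  exists (c : R) A b,
    [/\ 0 < c,
        generalized_automorphism mu (fun X Y Z => c * H X Y Z) A b,
        forall X Y, g' (A X) (A Y) = c * g X Y &
        forall X Y Z, H' (A X) (A Y) (A Z) = c * H X Y Z].

Definition wedge3 (a b c : V -> R) : V -> V -> V -> R := fun X Y Z =>
  a X * (b Y * c Z - b Z * c Y)
  - a Y * (b X * c Z - b Z * c X)
  + a Z * (b X * c Y - b Y * c X).

(* The vectors of a 4-tuple e and its dual basis, indexed from 1 to 4. *)
Definition vec (e : 4.-tuple V) (i : nat) : V := e`_i.-1.

Definition cov (e : 4.-tuple V) (i : nat) : V -> R := coord e (inord i.-1).

Definition cov3 (e : 4.-tuple V) (i j k : nat) : V -> V -> V -> R :=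
  wedge3 (cov e i) (cov e j) (cov e k).

Definition n3R_basis mu (e : 4.-tuple V) : Prop :=
  mu (vec e 1) (vec e 2) = vec e 3 /\
  [/\ mu (vec e 1) (vec e 3) = 0, mu (vec e 1) (vec e 4) = 0,
      mu (vec e 2) (vec e 3) = 0, mu (vec e 2) (vec e 4) = 0 &
      mu (vec e 3) (vec e 4) = 0].

Definition soliton1 mu g H (lam : R) D (e : 4.-tuple V) : Prop :=
  [/\ orthonormal_basis g e, n3R_basis mu e,
      forall X Y Z, H X Y Z = cov3 e 1 2 3 X Y Z,
      lam = -2 &
      [/\ D (vec e 1) = vec e 1, D (vec e 2) = vec e 2,
          D (vec e 3) = 2 *: vec e 3 & D (vec e 4) = 2 *: vec e 4]].

(* D has diagonal (1 - l2^2/2, 1 - l1^2/2, 3/2, 1); its e_1, e_2 entries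
   - l1 l2 / 2 come from H^2(e_1, e_2) = 2 l1 l2, and they vanish exactly when
   the orthonormal basis diagonalizes Ric^B. *)
Definition soliton2 mu g H (lam : R) D (e : 4.-tuple V) (l1 l2 : R) : Prop :=
  [/\ orthonormal_basis g e /\ n3R_basis mu e,
      l1 ^+ 2 + l2 ^+ 2 = 1,
      forall X Y Z,
        H X Y Z = l1 * cov3 e 2 3 4 X Y Z + l2 * cov3 e 1 3 4 X Y Z,
      lam = - (3 / 2) &
      [/\ D (vec e 1) = (1 - l2 ^+ 2 / 2) *: vec e 1 - (l1 * l2 / 2) *: vec e 2,
          D (vec e 2) = (1 - l1 ^+ 2 / 2) *: vec e 2 - (l1 * l2 / 2) *: vec e 1,
          D (vec e 3) = (3 / 2) *: vec e 3 &
          D (vec e 4) = vec e 4]].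

Definition integrable_complex_structure mu J : Prop :=
  (forall X, J (J X) = - X) /\
  (forall X Y, mu (J X) (J Y) - mu X Y - J (mu (J X) Y + mu X (J Y)) = 0).

Definition fundamental_form g J : V -> V -> R := fun X Y => g (J X) Y.

Definition pull2 J b : V -> V -> R := fun X Y => b (J X) (J Y).
Definition pull3 J H : V -> V -> V -> R := fun X Y Z => H (J X) (J Y) (J Z).

(* d^c = J^-1 d J, where J acts on k-forms by (J alpha)(X, ..) = alpha(JX, ..);
   hence d^c omega = - d omega (J., J., J.) for the fundamental form. *)
Definition dc2 mu J b : V -> V -> V -> R := pull3 (J^-1)%VF (d2 mu (pull2 J b)).

Definition dc_omega mu g J : V -> V -> V -> R :=
  dc2 mu J (fundamental_form g J).

Definition SKT mu g J : Prop :=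
  [/\ integrable_complex_structure mu J,
      inner_product g,
      forall X Y, g (J X) (J Y) = g X Y &
      forall X Y Z W, d3 mu (dc_omega mu g J) X Y Z W = 0].

(* The Bismut connection is the unique connection with totally skew torsion
   preserving g and J. *)
Definition bismut_connection mu g J nab : Prop :=
  [/\ bilinear_for *:%R *:%R nab,
      forall X Y Z, g (nab X Y) Z + g Y (nab X Z) = 0,
      forall X Y, nab X (J Y) = J (nab X Y) &
      three_form (fun X Y Z => g (nab X Y - nab Y X - mu X Y) Z)].

Definition bismut_ricci mu g J nab e : V -> V -> R := fun X Y =>
  2^-1 * \sum_(u <- e) g (curvature mu nab X Y (J u)) u.

Definition part11 J b : V -> V -> R := fun X Y =>
  2^-1 * (b X Y + pull2 J b X Y).

Definition is_transpose g D (Dt : 'End(V)) : Prop :=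
  forall X Y, g (D X) Y = g X (Dt Y).

Definition algebraic_pluriclosed_soliton mu g J : Prop :=
  SKT mu g J /\
  exists nab e P (lam : R) D (Dt : 'End(V)),
    [/\ bismut_connection mu g J nab, orthonormal_basis g e,
        forall X Y, fundamental_form g J (P X) Y =
                    part11 J (bismut_ricci mu g J nab e) X Y,
        derivation mu D /\ (forall X, D (J X) = J (D X)) &
        is_transpose g D Dt /\ P = lam *: \1%VF + 2^-1 *: (D + Dt)].

Definition is_pluriclosed_soliton mu g H : Prop :=
  exists J, algebraic_pluriclosed_soliton mu g J /\
            forall X Y Z, H X Y Z = dc_omega mu g J X Y Z.

End Geometry.

(* Main.v *)
(* A metric on n_3 + R has an orthonormal frame with mu(e_1, e_2) = a e_3 and
   e_3, e_4 central, obtained by Gram-Schmidt along the flag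
   [g, g] < center < g.  Write H = p e^123 + q e^124 + r e^134 + s e^234, which
   is always closed.  In a soliton, Ric^B - lambda Id is a symmetric derivation,
   so it is block diagonal for span(e_1, e_2), e_3, e_4, and its trace on
   span(e_1, e_2) is its eigenvalue on e_3.  The first fact leaves only p, only
   q, or only (r, s); the second gives
   lambda = - 3 a^2 / 2 - p^2 / 2 - q^2; the equation for Delta H then reads
   p^2 = a^2, q^2 = - a^2 or r^2 + s^2 = a^2, respectively.  Scaling by a^2
   normalizes a to 1.
   An orthogonal complex structure preserves the center and hence acts by
   e_1 -> +- e_2, e_3 -> +- e_4; both signs drop out of d^c omega = a e^123, so
   the SKT condition alone already forces the first soliton. *)
From HB Require Import structures.
Require Import Defs.
From mathcomp Require Import all_boot all_order all_algebra.
From mathcomp Require Import reals.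
From mathcomp Require Import ring lra.
Import Order.TTheory GRing.Theory Num.Theory.
Local Open Scope ring_scope.

(** * Linearity rules for maps given by bare linearity predicates *)

Section LinearMaps.
Context {R : realType} {V : lmodType R} {W : zmodType} {s : GRing.Scale.law R W}.

(** Packing [f] with its linearity proof into a bundled linear map gives access to the library
    rules; the next three lemmas use the same device. *)
Lemma linear_for_sum (f : V -> W) (lf : GRing.linear_for s f) (I : Type)
    (r : seq I) (F : I -> V) : f (\sum_(i <- r) F i) = \sum_(i <- r) f (F i).
Proof.
pose fM := GRing.isLinear.Build _ _ _ _ f lf.
pose fL : {linear V -> W | s} := HB.pack f fM.
exact: (linear_sum fL).
Qed.

Lemma linear_forD (f : V -> W) (lf : GRing.linear_for s f) x y :
  f (x + y) = f x + f y.
Proof.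
pose fM := GRing.isLinear.Build _ _ _ _ f lf.
pose fL : {linear V -> W | s} := HB.pack f fM.
exact: (linearD fL).
Qed.

Lemma linear_forN (f : V -> W) (lf : GRing.linear_for s f) x : f (- x) = - f x.
Proof.
pose fM := GRing.isLinear.Build _ _ _ _ f lf.
pose fL : {linear V -> W | s} := HB.pack f fM.
exact: (linearN fL).
Qed.

Lemma linear_forZ (f : V -> W) (lf : GRing.linear_for s f) a x :
  f (a *: x) = s a (f x).
Proof.
pose fM := GRing.isLinear.Build _ _ _ _ f lf.
pose fL : {linear V -> W | s} := HB.pack f fM.
exact: (linearZ_LR fL).
Qed.

Context {U : lmodType R} {f : V -> U -> W}.
Context (bf : bilinear_for s s f).

Lemma bilinearDl x y z : f (x + y) z = f x z + f y z.
Proof. exact: (linear_forD (f^~ z) (bf.1 z)). Qed.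

Lemma bilinearNl x z : f (- x) z = - f x z.
Proof. exact: (linear_forN (f^~ z) (bf.1 z)). Qed.

Lemma bilinearZl a x z : f (a *: x) z = s a (f x z).
Proof. exact: (linear_forZ (f^~ z) (bf.1 z)). Qed.

Lemma bilinear_suml (I : Type) (r : seq I) (F : I -> V) z :
  f (\sum_(i <- r) F i) z = \sum_(i <- r) f (F i) z.
Proof. exact: (linear_for_sum (f^~ z) (bf.1 z)). Qed.

End LinearMaps.

Section BilinearRight.
Context {R : realType} {V U : lmodType R} {W : zmodType} {s : GRing.Scale.law R W}.
Context {f : V -> U -> W} (bf : bilinear_for s s f).

Lemma bilinearDr x y z : f z (x + y) = f z x + f z y.
Proof. exact: (linear_forD _ (bf.2 z)). Qed.

Lemma bilinearZr a x z : f z (a *: x) = s a (f z x).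
Proof. exact: (linear_forZ _ (bf.2 z)). Qed.

Lemma bilinear_sumr (I : Type) (r : seq I) (F : I -> U) z :
  f z (\sum_(i <- r) F i) = \sum_(i <- r) f z (F i).
Proof. exact: (linear_for_sum _ (bf.2 z)). Qed.

End BilinearRight.

(** * Orthonormal bases and traces of bilinear maps *)

Section OrthonormalBases.
Context {R : realType} {V : vectType R}.
Implicit Types (g : V -> V -> R) (e : seq V).

(** Pairing a vanishing combination with a member of the sequence isolates its coefficient. *)
Lemma orthonormal_seq_free g e : inner_product g ->
  (forall i j, (i < size e)%N -> (j < size e)%N -> g e`_i e`_j = (i == j)%:R) ->
  free e.
Proof.
move=> [bg _ _] on; apply/(@freeP _ _ _ (in_tuple e)) => k k0 i.
have: g (\sum_(i < size e) k i *: e`_i) e`_i = 0.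
  by rewrite k0 -(scale0r 0) (bilinearZl bg) /= mul0r.
rewrite (bilinear_suml bg) (bigD1 i) //= (bilinearZl bg) /= on // eqxx.
rewrite mulr1 big1 ?addr0 // => j ji.
by rewrite (bilinearZl bg) /= on // val_eqE (negbTE ji) mulr0.
Qed.

Lemma orthonormal_expand g e X : inner_product g -> orthonormal_basis g e ->
  X = \sum_(u <- e) g X u *: u.
Proof.
move=> [bg _ _] [be on].
have EX : X = \sum_(i < size e) coord (in_tuple e) i X *: e`_i.
  exact: (@coord_basis _ _ fullv _ (in_tuple e) X be (memvf X)).
rewrite (big_nth 0) big_mkord {1}EX; apply: eq_bigr => i _; congr (_ *: _).
rewrite [in RHS]EX (bilinear_suml bg) (bigD1 i) //= (bilinearZl bg) /=.
rewrite on // eqxx mulr1 big1 ?addr0 // => j ji.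
by rewrite (bilinearZl bg) /= on // val_eqE (negbTE ji) mulr0.
Qed.

(** Each left argument [u] is expanded along [e']; after exchanging the sums, the sum over [u] is
    the expansion of [v] along [e] in the right argument. Values in a module [W] cover both scalar
    contractions and the vector [sharp]. *)
Lemma trace_orthonormal (W : lmodType R) g e e' (B : V -> V -> W) :
  inner_product g -> orthonormal_basis g e -> orthonormal_basis g e' ->
  bilinear_for *:%R *:%R B ->
  \sum_(u <- e) B u u = \sum_(v <- e') B v v.
Proof.
move=> ip oe oe' bB; have [_ gC _] := ip.
transitivity (\sum_(u <- e) \sum_(v <- e') g v u *: B v u).
  apply: eq_bigr => u _.
  rewrite {1}(orthonormal_expand g e' u ip oe') (bilinear_suml bB).
  by apply: eq_bigr => v _; rewrite (bilinearZl bB) gC.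
rewrite exchange_big; apply: eq_bigr => v _ /=.
rewrite [X in _ = B _ X](orthonormal_expand g e v ip oe) (bilinear_sumr bB).
by apply: eq_bigr => u _; rewrite (bilinearZr bB).
Qed.

(** [sharp] is the trace of the bilinear map sending [u], [v] to [phi u *: v]. *)
Lemma sharp_orthonormal g e e' (phi : V -> R) :
  inner_product g -> orthonormal_basis g e -> orthonormal_basis g e' ->
  scalar phi -> sharp e phi = sharp e' phi.
Proof.
move=> ip oe oe' lphi.
apply: (trace_orthonormal _ g e e' (fun u v => phi u *: v)) => //.
split=> [v a x y|u a x y] /=; first by rewrite lphi scalerDl scalerA.
by rewrite scalerDr !scalerA mulrC.
Qed.

End OrthonormalBases.

(** * Independence of the curvature and Hodge operators from the orthonormal basis *)

Section FrameIndependence.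
Context {R : realType} {V : vectType R} {mu : V -> V -> V} {g : V -> V -> R}.
Context (mu_lie : lie_bracket mu) (ip : inner_product g).
Implicit Types (H : V -> V -> V -> R) (e : seq V).

Lemma koszul_scalar X Y :
  scalar (fun Z => 2^-1 * (g (mu X Y) Z - g (mu Y Z) X + g (mu Z X) Y)).
Proof.
have [[bm _ _] [bg _ _]] := (mu_lie, ip) => a x y /=.
rewrite !(bilinearDl bm, bilinearDr bm, bilinearZl bm, bilinearZr bm).
rewrite !(bilinearDl bg, bilinearDr bg, bilinearZl bg, bilinearZr bg) /=.
ring.
Qed.

Lemma levi_civita_bilinear e : bilinear_for *:%R *:%R (levi_civita mu g e).
Proof.
have [[bm _ _] [bg _ _]] := (mu_lie, ip).
split=> [Y a x y|X a x y] /=; rewrite /levi_civita /sharp scaler_sumr -big_split;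
  apply: eq_bigr => u _ /=; rewrite scalerA -scalerDl; congr (_ *: _);
  rewrite !(bilinearDl bm, bilinearDr bm, bilinearZl bm, bilinearZr bm);
  rewrite !(bilinearDl bg, bilinearDr bg, bilinearZl bg, bilinearZr bg) /=; ring.
Qed.

(** Linearity in the first slot lets the Ricci trace change basis; linearity in the third slot,
    proved next, does the same for [sharp] in [ricci]. *)
Lemma curvature_linear1 e Y Z :
  linear (fun X => curvature mu (levi_civita mu g e) X Y Z).
Proof.
have [[bm _ _] bL] := (mu_lie, levi_civita_bilinear e) => a x y /=.
rewrite /curvature !(bilinearDl bm, bilinearZl bm).
rewrite !(bilinearDl bL, bilinearDr bL, bilinearZl bL, bilinearZr bL).
(* The expansion alternates terms in [x] and terms in [y]; the permutation gathers those in [x]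
   first. *)
by rewrite !scalerBr !opprD !addrA [LHS](AC 6 (1*3*5*2*4*6))%AC /=.
Qed.

Lemma curvature_linear3 e X Y :
  linear (fun Z => curvature mu (levi_civita mu g e) X Y Z).
Proof.
have bL := levi_civita_bilinear e => a x y /=.
rewrite /curvature !(bilinearDr bL, bilinearZr bL).
by rewrite !scalerBr !opprD !addrA [LHS](AC 6 (1*3*5*2*4*6))%AC /=.
Qed.

Context {e e' : seq V}.
Context (oe : orthonormal_basis g e) (oe' : orthonormal_basis g e').

Lemma levi_civita_orthonormal X Y :
  levi_civita mu g e X Y = levi_civita mu g e' X Y.
Proof. exact: (sharp_orthonormal g e e' _ ip oe oe' (koszul_scalar X Y)). Qed.

Lemma ricci_form_orthonormal X Y : ricci_form mu g e X Y = ricci_form mu g e' X Y.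
Proof.
have [bg _ _] := ip; rewrite /ricci_form.
transitivity (\sum_(u <- e) g (curvature mu (levi_civita mu g e') u X Y) u).
  by apply: eq_bigr => u _; rewrite /curvature !levi_civita_orthonormal.
apply: (@trace_orthonormal _ _ R^o g e e'
  (fun u v => g (curvature mu (levi_civita mu g e') u X Y) v)) => //.
split=> [v a x y|u a x y] /=.
  by rewrite curvature_linear1 (bilinearDl bg) (bilinearZl bg).
by rewrite (bilinearDr bg) (bilinearZr bg).
Qed.

Lemma ricci_orthonormal X : ricci mu g e X = ricci mu g e' X.
Proof.
have [bg _ _] := ip; rewrite /ricci -(sharp_orthonormal g e e' _ ip oe oe').
  by apply: eq_bigr => u _; rewrite ricci_form_orthonormal.
move=> a x y; rewrite /ricci_form mulr_sumr -big_split; apply: eq_bigr => u _.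
by rewrite curvature_linear3 (bilinearDl bg) (bilinearZl bg).
Qed.

Lemma H_square_orthonormal H X Y : three_form H ->
  H_square e H X Y = H_square e' H X Y.
Proof.
move=> [H1 H2 H3 _ _]; rewrite /H_square.
(* The basis is changed in one summation at a time, the inner one first. *)
transitivity (\sum_(u <- e) \sum_(v <- e') H X u v * H Y u v).
  apply: eq_bigr => u _.
  apply: (@trace_orthonormal _ _ R^o g e e' (fun v w => H X u v * H Y u w)) => //.
  split=> [v a x y|v a x y] /=.
    by rewrite H3 mulrDl -mulrA.
  by rewrite H3 mulrDr mulrCA.
apply: (@trace_orthonormal _ _ R^o g e e'
   (fun u w => \sum_(v <- e') H X u v * H Y w v)) => //.
split=> [v a x y|v a x y] /=; rewrite scaler_sumr -big_split;
  apply: eq_bigr => w _; rewrite H2.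
  by rewrite mulrDl -mulrA.
by rewrite mulrDr mulrCA.
Qed.

Lemma ricci_B_orthonormal H X : three_form H ->
  ricci_B mu g e H X = ricci_B mu g e' H X.
Proof.
move=> H3; rewrite /ricci_B ricci_orthonormal; congr (_ - _ *: _).
rewrite -(sharp_orthonormal g e e' _ ip oe oe').
  by apply: eq_bigr => u _; rewrite H_square_orthonormal.
have [H1 _ _ _ _] := H3 => a x y; rewrite /H_square mulr_sumr -big_split.
apply: eq_bigr => u _; rewrite mulr_sumr -big_split; apply: eq_bigr => v _ /=.
by rewrite H1 mulrDr mulrCA.
Qed.

Lemma codiff3_orthonormal H X Y : three_form H ->
  codiff3 mu g e H X Y = codiff3 mu g e' H X Y.
Proof.
move=> [H1 H2 H3 _ _]; have bL := levi_civita_bilinear e'; congr (- _).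
transitivity (\sum_(u <- e) nabla3 (levi_civita mu g e') u H u X Y).
  by apply: eq_bigr => u _; rewrite /nabla3 !levi_civita_orthonormal.
apply: (@trace_orthonormal _ _ R^o g e e'
  (fun u v => nabla3 (levi_civita mu g e') u H v X Y)) => //.
split=> [v a x y|u a x y] /=; rewrite /nabla3.
  by rewrite !(bilinearDl bL, bilinearZl bL) H1 H2 H3 /GRing.scale /=; ring.
by rewrite (bilinearDr bL) (bilinearZr bL) !H1 /GRing.scale /=; ring.
Qed.

Lemma laplacian_orthonormal H X Y Z : three_form H ->
  laplacian mu g e H X Y Z = laplacian mu g e' H X Y Z.
Proof. by move=> H3; rewrite /laplacian /d2 !codiff3_orthonormal. Qed.

End FrameIndependence.

(** * Coordinates of vectors and 3-forms in a basis of four vectors *)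

Section Coordinates.
Context {R : realType} {V : vectType R} (e : 4.-tuple V).

(** With all vectors in this shape, identities between vectors and forms become polynomial
    identities in coordinates, settled by [ring] or [field]. *)
Definition comb (x1 x2 x3 x4 : R) : V :=
  x1 *: vec e 1 + x2 *: vec e 2 + x3 *: vec e 3 + x4 *: vec e 4.

Lemma vecE : (vec e 1 = comb 1 0 0 0) * (vec e 2 = comb 0 1 0 0) *
  (vec e 3 = comb 0 0 1 0) * (vec e 4 = comb 0 0 0 1).
Proof. by rewrite /comb !scale0r !scale1r !addr0 !add0r. Qed.

Lemma combD x1 x2 x3 x4 y1 y2 y3 y4 :
  comb x1 x2 x3 x4 + comb y1 y2 y3 y4 =
  comb (x1 + y1) (x2 + y2) (x3 + y3) (x4 + y4).
Proof. by rewrite /comb !scalerDl !addrA [LHS](AC 8 (1*5*2*6*3*7*4*8))%AC. Qed.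

Lemma combZ c x1 x2 x3 x4 :
  c *: comb x1 x2 x3 x4 = comb (c * x1) (c * x2) (c * x3) (c * x4).
Proof. by rewrite /comb !scalerDr !scalerA. Qed.

Lemma combN x1 x2 x3 x4 : - comb x1 x2 x3 x4 = comb (- x1) (- x2) (- x3) (- x4).
Proof. by rewrite -scaleN1r combZ !mulN1r. Qed.

Lemma comb0 : 0 = comb 0 0 0 0.
Proof. by rewrite /comb !scale0r !addr0. Qed.

Lemma big_vec (W : nmodType) (F : V -> W) :
  \sum_(u <- e) F u = F (vec e 1) + F (vec e 2) + F (vec e 3) + F (vec e 4).
Proof.
rewrite /vec /=; case: e => [[|a [|b [|c [|d [|]]]]]] //= _.
by rewrite !big_cons big_nil addr0 !addrA.
Qed.

Lemma linear_comb {W : zmodType} {s : GRing.Scale.law R W} (f : V -> W)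
    (lf : GRing.linear_for s f) x1 x2 x3 x4 :
  f (comb x1 x2 x3 x4) =
  s x1 (f (vec e 1)) + s x2 (f (vec e 2)) + s x3 (f (vec e 3))
  + s x4 (f (vec e 4)).
Proof. by rewrite /comb !(linear_forD f lf, linear_forZ f lf). Qed.

Lemma combP X : basis_of fullv e -> exists x1 x2 x3 x4, X = comb x1 x2 x3 x4.
Proof.
move=> be; exists (cov e 1 X), (cov e 2 X), (cov e 3 X), (cov e 4 X).
rewrite {1}(coord_basis be (memvf X)) !big_ord_recr big_ord0 /= add0r /comb.
(* The summation indices and the [inord] indices of [cov] agree in value but not syntactically. *)
have E (i j : 'I_4) : i = j :> nat -> coord e i X = coord e j X.
  by move=> ij; congr (coord e _ X); apply: val_inj.
by do !congr (_ + _); congr (_ *: _); apply: E; rewrite /= inordK.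
Qed.

Lemma comb_cov : basis_of fullv e -> forall x1 x2 x3 x4,
  [/\ cov e 1 (comb x1 x2 x3 x4) = x1, cov e 2 (comb x1 x2 x3 x4) = x2,
      cov e 3 (comb x1 x2 x3 x4) = x3 & cov e 4 (comb x1 x2 x3 x4) = x4].
Proof.
move=> /basis_free fe x1 x2 x3 x4.
have C (i j : nat) : (i < 4)%N -> (j < 4)%N ->
    coord e (inord i) e`_j = (i == j)%:R.
  move=> i4 j4; rewrite -{1}(inordK j4) coord_free // -val_eqE /= !inordK //.
  by rewrite eq_sym.
by split; rewrite /cov /comb /vec !linearD !linearZ /= !C //=; ring.
Qed.

Lemma comb_inj : basis_of fullv e -> forall x1 x2 x3 x4 y1 y2 y3 y4,
  comb x1 x2 x3 x4 = comb y1 y2 y3 y4 -> [/\ x1 = y1, x2 = y2, x3 = y3 & x4 = y4].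
Proof.
move=> be x1 x2 x3 x4 y1 y2 y3 y4 xy.
have := comb_cov be x1 x2 x3 x4; rewrite xy.
by have [-> -> -> ->] := comb_cov be y1 y2 y3 y4; case=> -> -> -> ->.
Qed.

(** Supplies the derivations and the complex structure of the model solitons. *)
Lemma exists_endo (w1 w2 w3 w4 : V) : basis_of fullv e ->
  exists D : 'End(V), [/\ D (vec e 1) = w1, D (vec e 2) = w2,
    D (vec e 3) = w3 & D (vec e 4) = w4].
Proof.
move=> /basis_free fe.
have [f fE] := linear_of_free e [:: w1; w2; w3; w4].
have {}fE := fE fe (esym (size_tuple e)).
have E i : (i < 4)%N -> linfun f e`_i = [:: w1; w2; w3; w4]`_i.
  by move=> i4; rewrite lfunE -fE (nth_map 0) ?size_tuple.
by exists (linfun f); split; rewrite /vec E.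
Qed.

(** The coefficients follow the order e^123, e^124, e^134, e^234; hence in [soliton2] the parameter
    [l2] plays the role of [r] and [l1] that of [s]. *)
Definition form4 (p q r s : R) : V -> V -> V -> R := fun X Y Z =>
  p * cov3 e 1 2 3 X Y Z + q * cov3 e 1 2 4 X Y Z
  + r * cov3 e 1 3 4 X Y Z + s * cov3 e 2 3 4 X Y Z.

(** The 3 by 3 determinant with one row per vector, expanded along the first column; each e^ijk
    evaluates to such a minor of the coordinates. *)
Definition det3 (x y z x' y' z' x'' y'' z'' : R) : R :=
  x * (y' * z'' - y'' * z') - x' * (y * z'' - y'' * z)
  + x'' * (y * z' - y' * z).

Lemma form4_comb p q r s x1 x2 x3 x4 y1 y2 y3 y4 z1 z2 z3 z4 :
  basis_of fullv e ->
  form4 p q r s (comb x1 x2 x3 x4) (comb y1 y2 y3 y4) (comb z1 z2 z3 z4) =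
  p * det3 x1 x2 x3 y1 y2 y3 z1 z2 z3 + q * det3 x1 x2 x4 y1 y2 y4 z1 z2 z4
  + r * det3 x1 x3 x4 y1 y3 y4 z1 z3 z4 + s * det3 x2 x3 x4 y2 y3 y4 z2 z3 z4.
Proof.
move=> be; rewrite /form4 /cov3 /wedge3 /det3.
have [-> -> -> ->] := comb_cov be x1 x2 x3 x4.
have [-> -> -> ->] := comb_cov be y1 y2 y3 y4.
by have [-> -> -> ->] := comb_cov be z1 z2 z3 z4.
Qed.

Lemma form4_three_form p q r s : basis_of fullv e -> three_form (form4 p q r s).
Proof.
move=> be; split.
- move=> Y Z c X X'; rewrite /form4 /cov3 /wedge3 /cov !linearP /=; ring.
- move=> X Z c Y Y'; rewrite /form4 /cov3 /wedge3 /cov !linearP /=; ring.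
- move=> X Y c Z Z'; rewrite /form4 /cov3 /wedge3 /cov !linearP /=; ring.
- by move=> X Z; rewrite /form4 /cov3 /wedge3; ring.
- by move=> X Z; rewrite /form4 /cov3 /wedge3; ring.
Qed.

Lemma eq_form4_three_form {H p q r s} : basis_of fullv e ->
  (forall X Y Z, H X Y Z = form4 p q r s X Y Z) -> three_form H.
Proof.
move=> be HE; have [h1 h2 h3 h4 h5] := form4_three_form p q r s be.
by split=> *; rewrite ?HE //; move=> c x y; rewrite !HE ?h1 ?h2 ?h3.
Qed.

(** Polarization turns alternation into antisymmetry, so the trilinear expansion is determined by
    the values on increasing triples of basis vectors. *)
Lemma three_form_form4 H : basis_of fullv e -> three_form H ->
  exists p q r s, forall X Y Z, H X Y Z = form4 p q r s X Y Z.
Proof.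
move=> be [H1 H2 H3 Hxx Hzz].
have H12 X Y Z : H X Y Z = - H Y X Z.
  have := Hxx (X + Y) Z; rewrite (linear_forD _ (H1 _ _)) !(linear_forD _ (H2 _ _)).
  by rewrite !Hxx addr0 add0r => /addr0_eq <-; rewrite opprK.
have H23 X Y Z : H X Y Z = - H X Z Y.
  have := Hzz X (Y + Z); rewrite (linear_forD _ (H2 _ _)) !(linear_forD _ (H3 _ _)).
  by rewrite !Hzz addr0 add0r => /addr0_eq <-; rewrite opprK.
have H13 X Z : H X Z X = 0 by rewrite H12 Hzz oppr0.
pose v i := vec e i.
exists (H (v 1) (v 2) (v 3)), (H (v 1) (v 2) (v 4)),
  (H (v 1) (v 3) (v 4)), (H (v 2) (v 3) (v 4)) => X Y Z; rewrite /v.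
have [x1 [x2 [x3 [x4 ->]]]] := combP X be.
have [y1 [y2 [y3 [y4 ->]]]] := combP Y be.
have [z1 [z2 [z3 [z4 ->]]]] := combP Z be.
rewrite form4_comb // /det3 (linear_comb _ (H1 _ _)) !(linear_comb _ (H2 _ _)).
rewrite !(linear_comb _ (H3 _ _)) !Hxx !Hzz !H13 /=.
(* Only swaps of a decreasing pair are listed, so each rewrite lowers the number of inversions and
   rewriting stops at increasing indices. *)
pose sorts := (H12 (vec e 2) (vec e 1), H12 (vec e 3) (vec e 1),
  H12 (vec e 3) (vec e 2), H12 (vec e 4) (vec e 1), H12 (vec e 4) (vec e 2),
  H12 (vec e 4) (vec e 3), (fun W => H23 W (vec e 2) (vec e 1)),
  (fun W => H23 W (vec e 3) (vec e 1)),
  (fun W => H23 W (vec e 3) (vec e 2)), (fun W => H23 W (vec e 4) (vec e 1)),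
  (fun W => H23 W (vec e 4) (vec e 2)), (fun W => H23 W (vec e 4) (vec e 3))).
rewrite !sorts.
ring.
Qed.

End Coordinates.

(** * Curvature and Laplacian in a Heisenberg frame *)

Section HeisenbergFrames.
Context {R : realType} {V : vectType R}.

(** The structure constant [a] stays free because the metric is arbitrary; a later rescaling
    normalizes it to 1. *)
Definition heisenberg_frame (mu : V -> V -> V) (g : V -> V -> R) (a : R)
    (e : 4.-tuple V) : Prop :=
  [/\ orthonormal_basis g e, mu (vec e 1) (vec e 2) = a *: vec e 3,
      forall X, mu (vec e 3) X = 0 & forall X, mu (vec e 4) X = 0].

Context {mu : V -> V -> V} {g : V -> V -> R} {a : R} {e : 4.-tuple V}.
Context (mu_lie : lie_bracket mu) (ip : inner_product g).
Context (fr : heisenberg_frame mu g a e).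

Let be : basis_of fullv e. Proof. by case: fr => -[]. Qed.
Let oe : orthonormal_basis g e. Proof. by case: fr. Qed.

Lemma bracketC X Y : mu X Y = - mu Y X.
Proof.
have [bm mxx _] := mu_lie; have := mxx (X + Y).
rewrite (bilinearDl bm) !(bilinearDr bm) !mxx addr0 add0r => /addr0_eq <-.
by rewrite opprK.
Qed.

Lemma bracket_comb x1 x2 x3 x4 y1 y2 y3 y4 :
  mu (comb e x1 x2 x3 x4) (comb e y1 y2 y3 y4) =
  comb e 0 0 (a * (x1 * y2 - x2 * y1)) 0.
Proof.
have [[bm mxx _] [_ m12 m3 m4]] := (mu_lie, fr).
rewrite (linear_comb e _ (bm.1 _)) !(linear_comb e _ (bm.2 _)) !m3 !m4 !mxx.
rewrite !(bracketC _ (vec e 3)) !(bracketC _ (vec e 4)) !m3 !m4.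
rewrite (bracketC (vec e 2)) m12 !vecE /= !(comb0 e) !(combN, combZ, combD).
by congr (comb _ _ _ _ _); ring.
Qed.

Lemma inner_comb x1 x2 x3 x4 y1 y2 y3 y4 :
  g (comb e x1 x2 x3 x4) (comb e y1 y2 y3 y4) =
  x1 * y1 + x2 * y2 + x3 * y3 + x4 * y4.
Proof.
have [[bg _ _] [_ on]] := (ip, oe); rewrite size_tuple in on.
rewrite (linear_comb e _ (bg.1 _)) !(linear_comb e _ (bg.2 _)) /vec !on //=.
ring.
Qed.

Lemma levi_civita_comb x1 x2 x3 x4 y1 y2 y3 y4 :
  levi_civita mu g e (comb e x1 x2 x3 x4) (comb e y1 y2 y3 y4) =
  comb e (a / 2 * (x2 * y3 + x3 * y2)) (- (a / 2 * (x1 * y3 + x3 * y1)))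
    (a / 2 * (x1 * y2 - x2 * y1)) 0.
Proof.
rewrite /levi_civita /sharp big_vec !vecE !bracket_comb !inner_comb.
by rewrite !(combZ, combD); congr (comb _ _ _ _ _); field.
Qed.

Lemma ricci_comb x1 x2 x3 x4 :
  ricci mu g e (comb e x1 x2 x3 x4) =
  comb e (- (a ^+ 2 / 2 * x1)) (- (a ^+ 2 / 2 * x2)) (a ^+ 2 / 2 * x3) 0.
Proof.
rewrite /ricci /ricci_form /sharp !big_vec !vecE /curvature.
rewrite !(levi_civita_comb, bracket_comb) !(combN, combD) !inner_comb.
by rewrite !(combZ, combD); congr (comb _ _ _ _ _); field.
Qed.

Context {H : V -> V -> V -> R} {p q r s : R}.
Context (HE : forall X Y Z, H X Y Z = form4 e p q r s X Y Z).

Lemma three_form_comb x1 x2 x3 x4 y1 y2 y3 y4 z1 z2 z3 z4 :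
  H (comb e x1 x2 x3 x4) (comb e y1 y2 y3 y4) (comb e z1 z2 z3 z4) =
  p * det3 x1 x2 x3 y1 y2 y3 z1 z2 z3 + q * det3 x1 x2 x4 y1 y2 y4 z1 z2 z4
  + r * det3 x1 x3 x4 y1 y3 y4 z1 z3 z4 + s * det3 x2 x3 x4 y2 y3 y4 z2 z3 z4.
Proof. by rewrite HE form4_comb. Qed.

(** In this frame [ricci] is diagonal, so every off-diagonal entry comes from the term - H^2 / 4. *)
Lemma ricci_B_comb x1 x2 x3 x4 :
  ricci_B mu g e H (comb e x1 x2 x3 x4) =
  comb e
    (- ((a ^+ 2 + p ^+ 2 + q ^+ 2 + r ^+ 2) / 2 * x1) - r * s / 2 * x2
     + q * s / 2 * x3 - p * s / 2 * x4)
    (- (r * s / 2 * x1) - (a ^+ 2 + p ^+ 2 + q ^+ 2 + s ^+ 2) / 2 * x2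
     - q * r / 2 * x3 + p * r / 2 * x4)
    (q * s / 2 * x1 - q * r / 2 * x2
     + (a ^+ 2 - p ^+ 2 - r ^+ 2 - s ^+ 2) / 2 * x3 - p * q / 2 * x4)
    (- (p * s / 2 * x1) + p * r / 2 * x2 - p * q / 2 * x3
     - (q ^+ 2 + r ^+ 2 + s ^+ 2) / 2 * x4).
Proof.
rewrite /ricci_B ricci_comb /H_square /sharp !big_vec !vecE !three_form_comb.
rewrite /det3 !(combZ, combD, combN).
by congr (comb _ _ _ _ _); field.
Qed.

(** The forms e^123, e^134 and e^234 are coclosed; the codifferential of [H] is - a q e^34. *)
Lemma codiff3_comb x1 x2 x3 x4 y1 y2 y3 y4 :
  codiff3 mu g e H (comb e x1 x2 x3 x4) (comb e y1 y2 y3 y4) =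
  - (a * q * (x3 * y4 - x4 * y3)).
Proof.
rewrite /codiff3 /nabla3 !big_vec !vecE !levi_civita_comb !three_form_comb /det3.
by field.
Qed.

Lemma laplacian_comb x1 x2 x3 x4 y1 y2 y3 y4 z1 z2 z3 z4 :
  laplacian mu g e H (comb e x1 x2 x3 x4) (comb e y1 y2 y3 y4)
    (comb e z1 z2 z3 z4) =
  - (a ^+ 2 * q * det3 x1 x2 x4 y1 y2 y4 z1 z2 z4).
Proof.
by rewrite /laplacian /d2 !bracket_comb !codiff3_comb /det3; ring.
Qed.

(** A nilpotent Lie algebra is unimodular, so in dimension four the differential kills all 3-forms;
    in coordinates this is a polynomial identity. *)
Lemma three_form_closed X Y Z W : d3 mu H X Y Z W = 0.
Proof.
have [x1 [x2 [x3 [x4 ->]]]] := combP e X be.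
have [y1 [y2 [y3 [y4 ->]]]] := combP e Y be.
have [z1 [z2 [z3 [z4 ->]]]] := combP e Z be.
have [w1 [w2 [w3 [w4 ->]]]] := combP e W be.
by rewrite /d3 !bracket_comb !three_form_comb /det3; ring.
Qed.

Lemma heisenberg_nilpotent : lie_nilpotent mu.
Proof.
(* Brackets are multiples of the central vector e_3, so two nested brackets vanish. *)
exists 2 => -[|X [|Y []]] // Z _ /=.
have [x1 [x2 [x3 [x4 ->]]]] := combP e X be.
have [y1 [y2 [y3 [y4 ->]]]] := combP e Y be.
have [z1 [z2 [z3 [z4 ->]]]] := combP e Z be.
by rewrite !bracket_comb (comb0 e); congr (comb _ _ _ _ _); ring.
Qed.

End HeisenbergFrames.

(** * Existence of an orthonormal frame adapted to the center and the derived algebra *)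

Section FrameExistence.
Context {R : realType} {V : vectType R}.

(** The recursion starts from the end of the list and so preserves the span of each tail. A flag is
    respected by putting its smallest member last. *)
Lemma gram_schmidt (g : V -> V -> R) (s : seq V) : inner_product g -> free s ->
  exists t : seq V, [/\ size t = size s,
    forall i j, (i < size t)%N -> (j < size t)%N -> g t`_i t`_j = (i == j)%:R &
    forall k, (<<drop k t>> = <<drop k s>>)%VS].
Proof.
move=> ip; have [bg gC gpos] := ip.
elim: s => [|v s IHs]; first by exists [::].
rewrite free_cons => /andP[vs /IHs[t [szt ont spt]]].
have spts : (<<t>> = <<s>>)%VS by have := spt 0%N; rewrite !drop0.
(* [m] is the orthogonal projection of [v] to the span of the tail, and [w] is nonzero because [v]
   lies outside that span. *)
pose m := \sum_(i < size t) g v t`_i *: t`_i; pose w := v - m.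
have mt : m \in <<t>>%VS.
  by apply: memv_suml => i _; apply: memvZ; apply: memv_span; apply: mem_nth.
have w0 : w != 0.
  by apply: contra vs; rewrite subr_eq0 => /eqP->; rewrite -spts.
have gw := gpos w w0; pose c := (Num.sqrt (g w w))^-1.
have c0 : c != 0 by rewrite invr_eq0 gt_eqF // sqrtr_gt0.
have gwt j : (j < size t)%N -> g w t`_j = 0.
  move=> jt; rewrite /w (bilinearDl bg) (bilinearNl bg) (bilinear_suml bg).
  rewrite (bigD1 (Ordinal jt)) //= (bilinearZl bg) /= ont // eqxx mulr1.
  rewrite big1 ?addr0 ?subrr // => i ij.
  by rewrite (bilinearZl bg) /= ont // -[X in _ == X]/(val (Ordinal jt)) val_eqE
    (negbTE ij) mulr0.
exists (c *: w :: t); split; first by rewrite /= szt.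
  move=> [|i] [|j] //= it jt.
  - rewrite (bilinearZl bg) (bilinearZr bg) /= mulrA -invfM -expr2.
    by rewrite sqr_sqrtr ?ltW // mulVf ?gt_eqF.
  - by rewrite (bilinearZl bg) /= gwt // mulr0.
  - by rewrite gC (bilinearZl bg) /= gwt // mulr0.
  - by rewrite ont.
case=> [|k] /=; last exact: spt.
have vE : v = w + m by rewrite subrK.
apply/eqP; rewrite eqEsubv; apply/andP; split; apply/span_subvP => x.
  rewrite inE => /orP[/eqP->|xt]; last first.
    by rewrite span_cons -spts (subvP (addvSr _ _)) // memv_span.
  rewrite memvZ // memvB //; first by rewrite memv_span ?mem_head.
  by rewrite span_cons -spts (subvP (addvSr _ _)).
rewrite inE => /orP[/eqP->|xs]; last first.
  by rewrite span_cons spts (subvP (addvSr _ _)) // memv_span.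
rewrite vE memvD //; last by rewrite span_cons (subvP (addvSr _ _)).
by rewrite -[X in X \in _](scalerK c0) memvZ // memv_span // mem_head.
Qed.

(** The order [v1], [v2], [v4], [v3] makes the last two vectors span the center and the last one
    span [g, g], as [gram_schmidt] requires. *)
Lemma n3R_generators (mu : V -> V -> V) : lie_isomorphic mu (@n3R_bracket R) ->
  exists v1 v2 v3 v4 : V,
    [/\ basis_of fullv [:: v1; v2; v4; v3], mu v1 v2 = v3,
        forall X, mu v3 X = 0 & forall X, mu v4 X = 0].
Proof.
move=> [f [/eqP/lker0P fI fS fM]].
have fK y : f (f^-1%VF y) = y by apply: limg_lfunVK; rewrite fS memvf.
pose b (i : 'I_3) : 'rV[R]_3 * R^o := (delta_mx 0 i, 0).
pose b4 : 'rV[R]_3 * R^o := (0, 1).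
pose v1 := f^-1%VF (b 0); pose v2 := f^-1%VF (b 1).
pose v3 := f^-1%VF (b ord_max); pose v4 := f^-1%VF b4.
have fE c1 c2 c3 c4 : f (c1 *: v1 + (c2 *: v2 + (c4 *: v4 + c3 *: v3))) =
    (c1 *: delta_mx 0 0 + c2 *: delta_mx 0 1 + c3 *: delta_mx 0 ord_max, c4).
  rewrite !linearD !linearZ /= !fK; congr pair; rewrite /=.
    by rewrite scaler0 add0r addrA.
  by rewrite !scaler0 !add0r addr0 /GRing.scale /= mulr1.
have cE c1 c2 c3 c4 (u := f (c1 *: v1 + (c2 *: v2 + (c4 *: v4 + c3 *: v3)))) :
    [/\ u.1 0 0 = c1, u.1 0 1 = c2, u.1 0 ord_max = c3 & u.2 = c4].
  by rewrite /u fE; split; rewrite // !mxE /=; ring.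
have z3 X : mu v3 X = 0.
  apply: fI; rewrite fM fK linear0 /n3R_bracket /direct_sum_bracket /n3_bracket /=.
  by rewrite !mxE /= !mul0r subrr scale0r.
have z4 X : mu v4 X = 0.
  apply: fI; rewrite fM fK linear0 /n3R_bracket /direct_sum_bracket /n3_bracket /=.
  by rewrite !mxE /= !mul0r subrr scale0r.
exists v1, v2, v3, v4; split=> //.
  rewrite basisEfree; apply/and3P; split; last 2 first.
  - exact: subvf.
  - apply: leq_trans (dim_span _); apply: dimvS; apply/subvP => X _.
    pose y := f X.
    have -> : X = y.1 0 0 *: v1 + (y.1 0 1 *: v2 +
        (y.2 *: v4 + y.1 0 ord_max *: v3)).
      apply: fI; rewrite fE -/y [LHS]surjective_pairing; congr pair.
      apply/rowP => -[[|[|[|]]] // ?]; rewrite !mxE /=;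
        rewrite ?(mulr0, mulr1, addr0, add0r);
        by congr (y.1 _ _); apply: val_inj.
    by rewrite !memvD // memvZ // memv_span // !inE eqxx ?orbT.
  apply/(@freeP _ _ _ [tuple v1; v2; v4; v3]) => k.
  rewrite !big_ord_recl big_ord0 /= addr0 => k0.
  (* The list has [v4] before [v3], so the last two coefficients are interchanged. *)
  have [] := cE (k ord0) (k (lift ord0 ord0))
    (k (lift ord0 (lift ord0 (lift ord0 ord0))))
    (k (lift ord0 (lift ord0 ord0))).
  rewrite k0 linear0 /= !mxE => e1 e2 e3 e4 [[|[|[|[|]]]] // i4];
   [move: e1|move: e2|move: e4|move: e3] => /esym; apply: etrans;
   by congr (k _); apply: val_inj.
apply: fI; rewrite fM !fK /n3R_bracket /direct_sum_bracket /n3_bracket /= !mxE /=.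
by rewrite mulr1 mulr0 subr0 scale1r.
Qed.

Lemma heisenberg_frame_exists (mu : V -> V -> V) (g : V -> V -> R) :
  lie_bracket mu -> inner_product g -> lie_isomorphic mu (@n3R_bracket R) ->
  exists a e, a != 0 /\ heisenberg_frame mu g a e.
Proof.
move=> mu_lie ip /n3R_generators[v1 [v2 [v3 [v4 [bv m12 m3 m4]]]]].
have [bm mxx _] := mu_lie.
have [t [szt ont spt]] := gram_schmidt g _ ip (basis_free bv).
(* The names follow the order of the generators: third comes [u4], last comes [u3]. *)
case: t szt ont spt => [|u1 [|u2 [|u4 [|u3 [|]]]]] //= _ ont spt.
have bt : basis_of fullv [:: u1; u2; u3; u4].
  have st : (<<[:: u1; u2; u3; u4]>> = fullv :> {vspace V})%VS.
    have := spt 0%N; rewrite !drop0 (span_basis bv) => <-.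
    by apply: eq_span => x; rewrite !inE; case: (x == u3); case: (x == u4).
  by rewrite basisEdim st subvv /= (size_basis (X := [tuple v1; v2; v4; v3]) bv).
(* By the equality of tail spans, [u3] spans [g, g] and [u4], [u3] span the center. *)
have u3v : u3 \in <[v3]>%VS.
  by have := spt 3; rewrite /= !span_seq1 => <-; exact: memv_line.
have u4v : u4 \in <<[:: v4; v3]>>%VS.
  by have := spt 2; rewrite /= => <-; rewrite memv_span // mem_head.
have m3' X : mu u3 X = 0.
  by have /vlineP[k ->] := u3v; rewrite (bilinearZl bm) /= m3 scaler0.
have m4' X : mu u4 X = 0.
  move: u4v; rewrite span_cons span_seq1.
  move=> /memv_addP[_ /vlineP[k ->] [_ /vlineP[l ->] ->]].
  by rewrite (bilinearDl bm) !(bilinearZl bm) /= m3 m4 !scaler0 addr0.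
have v3u : v3 \in <[u3]>%VS.
  by have := spt 3; rewrite /= !span_seq1 => ->; exact: memv_line.
have oe : orthonormal_basis g [:: u1; u2; u3; u4].
  split=> // i j i4 j4.
  (* The index list sends positions in [u1], [u2], [u3], [u4] to positions in the Gram-Schmidt
     list. *)
  have := ont (nth 0%N [:: 0; 1; 3; 2] i) (nth 0%N [:: 0; 1; 3; 2] j).
  by case: i i4 => [|[|[|[|]]]] //; case: j j4 => [|[|[|[|]]]] //= _ _; exact.
suff [a m12'] : exists a, mu u1 u2 = a *: u3.
  exists a, [tuple u1; u2; u3; u4]; split; last by [].
  (* With [a] zero all brackets would vanish, whereas [mu v1 v2] is the basis vector [v3]. *)
  apply/eqP => a0.
  have fr : heisenberg_frame mu g a [tuple u1; u2; u3; u4] by [].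
  have [x1 [x2 [x3 [x4 v1E]]]] := combP [tuple u1; u2; u3; u4] v1 bt.
  have [y1 [y2 [y3 [y4 v2E]]]] := combP [tuple u1; u2; u3; u4] v2 bt.
  have := basis_not0 bv (_ : v3 \in _); rewrite !inE eqxx !orbT => /(_ isT).
  by rewrite -m12 v1E v2E (bracket_comb mu_lie fr) a0 mul0r -comb0 eqxx.
(* Every bracket is a multiple of [v3], hence of [u3]. *)
suff /vlineP[k ->] : mu u1 u2 \in <[v3]>%VS.
  by have /vlineP[l ->] := v3u; exists (k * l); rewrite scalerA.
have bv' : basis_of fullv [:: v1; v2; v3; v4].
  by rewrite (perm_basis (Y := [:: v1; v2; v4; v3])) //
    !perm_cons (perm_catC [:: v3] [:: v4]).
have [x1 [x2 [x3 [x4 ->]]]] := combP [tuple v1; v2; v3; v4] u1 bv'.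
have [y1 [y2 [y3 [y4 ->]]]] := combP [tuple v1; v2; v3; v4] u2 bv'.
rewrite (linear_comb _ _ (bm.1 _)) !(linear_comb _ _ (bm.2 _)) /vec /=.
have m3r X : mu X v3 = 0 by rewrite (bracketC mu_lie) m3 oppr0.
have m4r X : mu X v4 = 0 by rewrite (bracketC mu_lie) m4 oppr0.
rewrite !(mxx, m3, m4, m3r, m4r) (bracketC mu_lie v2) m12 !(scaler0, addr0, add0r).
by rewrite !scalerN !scalerA -scaleNr -scalerDl memvZ ?memv_line.
Qed.

End FrameExistence.

(** * Verification that the listed data are solitons *)

Section Solitons.
Context {R : realType} {V : vectType R} {mu : V -> V -> V}.
Context (mu_lie : lie_bracket mu).
Implicit Types (g : V -> V -> R) (H : V -> V -> V -> R) (e : 4.-tuple V).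

Lemma n3R_basis_frame {g e} :
  orthonormal_basis g e -> n3R_basis mu e -> heisenberg_frame mu g 1 e.
Proof.
move=> oe [m12 [m13 m14 m23 m24 m34]].
have [[bm mxx _] [be _]] := (mu_lie, oe).
split=> // [|X|X]; first by rewrite m12 scale1r.
  have [x1 [x2 [x3 [x4 ->]]]] := combP e X be.
  rewrite (linear_comb e _ (bm.2 _)) mxx m34 !(bracketC mu_lie (vec e 3)) m13 m23.
  by rewrite /= !(oppr0, scaler0, addr0).
have [x1 [x2 [x3 [x4 ->]]]] := combP e X be.
rewrite (linear_comb e _ (bm.2 _)) mxx !(bracketC mu_lie (vec e 4)) m14 m24 m34.
by rewrite /= !(oppr0, scaler0, addr0).
Qed.

(** Closedness of [H] and nilpotency are automatic in such a basis, which leaves the derivation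
    property and the two soliton equations to check. *)
Lemma n3R_basis_nilsoliton {g H lam} {D : 'End(V)} {e p q r s} :
  inner_product g -> orthonormal_basis g e -> n3R_basis mu e ->
  (forall X Y Z, H X Y Z = form4 e p q r s X Y Z) -> derivation mu D ->
  (forall X, ricci_B mu g e H X = lam *: X + D X) ->
  (forall X Y Z, laplacian mu g e H X Y Z =
    lam * H X Y Z + rho (ricci_B mu g e H) H X Y Z) ->
  generalized_nilsoliton mu g H lam D.
Proof.
move=> ip oe ne HE dD ricD lapH; have fr := n3R_basis_frame oe ne.
have [be _] := oe; split; last by exists e.
- split=> //; last exact: (three_form_closed mu_lie fr HE).
  exact: eq_form4_three_form be HE.
- exact: (heisenberg_nilpotent mu_lie fr).
- exact: dD.
Qed.

(* The sign eps covers both H = e^123 and H = - e^123. *)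
Lemma soliton1_nilsoliton {g H} {D : 'End(V)} {e} {eps : R} :
  inner_product g -> orthonormal_basis g e -> n3R_basis mu e ->
  eps ^+ 2 = 1 -> (forall X Y Z, H X Y Z = eps * cov3 e 1 2 3 X Y Z) ->
  [/\ D (vec e 1) = vec e 1, D (vec e 2) = vec e 2,
      D (vec e 3) = 2 *: vec e 3 & D (vec e 4) = 2 *: vec e 4] ->
  generalized_nilsoliton mu g H (-2) D /\ non_classical H.
Proof.
move=> ip oe ne eps2 HD [D1 D2 D3 D4].
have [fr [be _]] := (n3R_basis_frame oe ne, oe).
have HE X Y Z : H X Y Z = form4 e eps 0 0 0 X Y Z.
  by rewrite HD /form4 !mul0r !addr0.
have DE x1 x2 x3 x4 : D (comb e x1 x2 x3 x4) = comb e x1 x2 (2 * x3) (2 * x4).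
  rewrite (linear_comb e D (linearP D)) /= D1 D2 D3 D4 /comb !scalerA.
  by rewrite ![_ * 2]mulrC.
have ricE x1 x2 x3 x4 : ricci_B mu g e H (comb e x1 x2 x3 x4) =
    comb e (- x1) (- x2) 0 0.
  by rewrite (ricci_B_comb mu_lie ip fr HE); congr (comb _ _ _ _ _); field: eps2.
split; last first.
  move=> /(_ (vec e 1) (vec e 2) (vec e 3)).
  rewrite !vecE HE (form4_comb _ _ _ _ _ _ _ _ _ _ _ _ _ _ _ _ _ be) /det3 => h.
  have eps0 : eps = 0 by rewrite -h; ring.
  by move: eps2; rewrite eps0 expr0n => /esym/eqP; rewrite oner_eq0.
apply: (n3R_basis_nilsoliton ip oe ne HE).
- move=> X Y.
  have [x1 [x2 [x3 [x4 ->]]]] := combP e X be.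
  have [y1 [y2 [y3 [y4 ->]]]] := combP e Y be.
  rewrite !DE !(bracket_comb mu_lie fr) DE combD; congr (comb _ _ _ _ _); ring.
- move=> X; have [x1 [x2 [x3 [x4 ->]]]] := combP e X be.
  rewrite DE combZ combD ricE; congr (comb _ _ _ _ _); ring.
- move=> X Y Z.
  have [x1 [x2 [x3 [x4 ->]]]] := combP e X be.
  have [y1 [y2 [y3 [y4 ->]]]] := combP e Y be.
  have [z1 [z2 [z3 [z4 ->]]]] := combP e Z be.
  rewrite (laplacian_comb mu_lie ip fr HE) /rho !ricE !(three_form_comb fr HE) /det3.
  ring.
Qed.

Lemma soliton2_nilsoliton {g H lam} {D : 'End(V)} {e l1 l2} :
  inner_product g -> soliton2 mu g H lam D e l1 l2 ->
  generalized_nilsoliton mu g H lam D /\ non_classical H.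
Proof.
move=> ip [[oe ne] l12 HD -> [D1 D2 D3 D4]].
have [fr [be _]] := (n3R_basis_frame oe ne, oe).
(* Oriented form of the circle relation, modulo which [field] works below. *)
have l1E : l1 ^+ 2 = 1 - l2 ^+ 2 by rewrite -l12; ring.
have HE X Y Z : H X Y Z = form4 e 0 0 l2 l1 X Y Z.
  by rewrite HD /form4 !mul0r !add0r addrC.
have DE x1 x2 x3 x4 : D (comb e x1 x2 x3 x4) =
    comb e ((1 - l2 ^+ 2 / 2) * x1 - l1 * l2 / 2 * x2)
      ((1 - l1 ^+ 2 / 2) * x2 - l1 * l2 / 2 * x1) (3 / 2 * x3) x4.
  rewrite (linear_comb e D (linearP D)) /= D1 D2 D3 D4 !vecE.
  by rewrite !(combZ, combN, combD); congr (comb _ _ _ _ _); ring.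
have ricE x1 x2 x3 x4 : ricci_B mu g e H (comb e x1 x2 x3 x4) =
    comb e (- ((1 + l2 ^+ 2) / 2 * x1) - l1 * l2 / 2 * x2)
      (- ((1 + l1 ^+ 2) / 2 * x2) - l1 * l2 / 2 * x1) 0 (- (x4 / 2)).
  by rewrite (ricci_B_comb mu_lie ip fr HE); congr (comb _ _ _ _ _); field: l1E.
split; last first.
  move=> H0; have := H0 (vec e 1) (vec e 3) (vec e 4).
  have := H0 (vec e 2) (vec e 3) (vec e 4).
  rewrite !vecE !(three_form_comb fr HE) /det3 => h1 h2.
  have l10 : l1 = 0 by rewrite -h1; ring.
  have l20 : l2 = 0 by rewrite -h2; ring.
  by move: l12; rewrite l10 l20 expr0n addr0 => /esym/eqP; rewrite oner_eq0.
apply: (n3R_basis_nilsoliton ip oe ne HE).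
- move=> X Y.
  have [x1 [x2 [x3 [x4 ->]]]] := combP e X be.
  have [y1 [y2 [y3 [y4 ->]]]] := combP e Y be.
  rewrite !DE !(bracket_comb mu_lie fr) DE combD.
  by congr (comb _ _ _ _ _); field: l1E.
- move=> X; have [x1 [x2 [x3 [x4 ->]]]] := combP e X be.
  by rewrite DE combZ combD ricE; congr (comb _ _ _ _ _); field: l1E.
- move=> X Y Z.
  have [x1 [x2 [x3 [x4 ->]]]] := combP e X be.
  have [y1 [y2 [y3 [y4 ->]]]] := combP e Y be.
  have [z1 [z2 [z3 [z4 ->]]]] := combP e Z be.
  rewrite (laplacian_comb mu_lie ip fr HE) /rho !ricE !(three_form_comb fr HE) /det3.
  by field: l1E.
Qed.

End Solitons.

(** * Scaling equivalence and normalization of the frame *)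

Section Rescaling.
Context {R : realType} {V : vectType R} {mu : V -> V -> V}.
Context {g : V -> V -> R} {a : R} {e : 4.-tuple V}.
Context (mu_lie : lie_bracket mu) (ip : inner_product g).
Context (fr : heisenberg_frame mu g a e) (a0 : a != 0).

Lemma inner_product_scale c : 0 < c -> inner_product (fun X Y => c * g X Y).
Proof.
move=> c0; have [bg gC gpos] := ip; split=> [|X Y|X X0].
- split=> [Y k X X'|X k Y Y'] /=;
    rewrite !(bilinearDl bg, bilinearDr bg, bilinearZl bg, bilinearZr bg) /=; ring.
- by rewrite gC.
- by rewrite mulr_gt0 ?gpos.
Qed.

Lemma generalized_equivalent_scale H c : 0 < c ->
  generalized_equivalent mu g H (fun X Y => c * g X Y)
    (fun X Y Z => c * H X Y Z).
Proof.
(* Pure scaling: the automorphism is the identity and the 2-form is zero. *)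
move=> c0; exists c, \1%VF, (fun _ _ => 0); split=> // [|X Y|X Y Z].
- split=> [||X Y Z].
  + by split=> [|X Y]; rewrite ?lker0_lfun1 ?id_lfunE //;
      apply/eqP; apply/lker0P => x y; rewrite !id_lfunE.
  + split=> //; split=> [Y k X X'|X k Y Y'] /=; by rewrite mulr0 addr0.
  + by rewrite !id_lfunE /d2; ring.
- by rewrite !id_lfunE.
- by rewrite !id_lfunE.
Qed.

(** The vectors e_i / a are orthonormal for [a ^+ 2 * g], and the bracket of the first two is a e_3
    / a^2, the new third vector. Dual covectors are multiplied by [a], so the coefficients of the
    scaled 3-form change by a^2 / a^3. *)
Lemma unit_frame : exists e' : 4.-tuple V,
  [/\ orthonormal_basis (fun X Y => a ^+ 2 * g X Y) e', n3R_basis mu e' &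
    forall H p q r s, (forall X Y Z, H X Y Z = form4 e p q r s X Y Z) ->
      forall X Y Z, a ^+ 2 * H X Y Z =
        form4 e' (p / a) (q / a) (r / a) (s / a) X Y Z].
Proof.
have [[be on] m12 m3 m4] := fr; have [[bg _ _] [bm mxx _]] := (ip, mu_lie).
have ip' := inner_product_scale (a ^+ 2) _.
have {}ip' : inner_product (fun X Y => a ^+ 2 * g X Y).
  by apply: ip'; rewrite exprn_even_gt0.
pose e' := [tuple of map (fun u => a^-1 *: u) e].
have e'E i : (i < 4)%N -> e'`_i = a^-1 *: e`_i.
  by move=> i4; rewrite (nth_map 0) ?size_tuple.
have on' i j : (i < size e')%N -> (j < size e')%N ->
    a ^+ 2 * g e'`_i e'`_j = (i == j)%:R.
  rewrite !size_tuple => i4 j4; rewrite !e'E // (bilinearZl bg) (bilinearZr bg) /=.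
  by rewrite on ?size_tuple //; field.
have be' : basis_of fullv e'.
  rewrite basisEfree (orthonormal_seq_free _ _ ip' on') subvf /=.
  by rewrite size_tuple (size_basis be).
have vE i : (i.-1 < 4)%N -> vec e i = a *: vec e' i.
  by move=> i4; rewrite /vec e'E // scalerA divff // scale1r.
have combE x1 x2 x3 x4 : comb e x1 x2 x3 x4 =
    comb e' (a * x1) (a * x2) (a * x3) (a * x4).
  by rewrite /comb !vE // !scalerA ![_ * a]mulrC.
exists e'; split=> //.
  have vE' i : (i.-1 < 4)%N -> vec e' i = a^-1 *: vec e i by exact: e'E.
  split; last split; rewrite !vE' // (bilinearZl bm) (bilinearZr bm) /=;
    rewrite ?(m3, m4, m12, bracketC mu_lie _ (vec e 3), bracketC mu_lie _ (vec e 4));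
    rewrite ?oppr0 ?scaler0 //.
  by rewrite !scalerA; congr (_ *: _); field.
move=> H p q r s HE X Y Z.
have [x1 [x2 [x3 [x4 ->]]]] := combP e X be.
have [y1 [y2 [y3 [y4 ->]]]] := combP e Y be.
have [z1 [z2 [z3 [z4 ->]]]] := combP e Z be.
by rewrite (three_form_comb fr HE) !combE form4_comb // /det3; field.
Qed.

End Rescaling.

(** * Classification of the non-classical nilsolitons *)

Section Classification.
Context {R : realType} {V : vectType R} {mu : V -> V -> V}.
Context {g : V -> V -> R} {a : R} {e : 4.-tuple V}.
Context (mu_lie : lie_bracket mu).
Context (fr : heisenberg_frame mu g a e) (a0 : a != 0).

Lemma nilsoliton_components {H lam} {D : 'End(V)} {p q r s} :
  (forall X Y Z, H X Y Z = form4 e p q r s X Y Z) ->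
  generalized_nilsoliton mu g H lam D -> non_classical H ->
  (p ^+ 2 = a ^+ 2 /\ [/\ q = 0, r = 0 & s = 0]) \/
  (r ^+ 2 + s ^+ 2 = a ^+ 2 /\ p = 0 /\ q = 0).
Proof.
move=> HE [[_ ip H3 _] _ dD [f [of_ ricD lapH]]] Hn0.
have [oe _ _ _] := fr; have [be _] := oe.
(* The soliton equations are given in the basis [f]; basis independence moves them to the adapted
   frame [e]. *)
have ricD' X : D X = ricci_B mu g e H X - lam *: X.
  by rewrite -(ricci_B_orthonormal mu_lie ip of_ oe _ _ H3) ricD addrC addKr.
have lapH' X Y Z : laplacian mu g e H X Y Z =
    lam * H X Y Z + rho (ricci_B mu g e H) H X Y Z.
  rewrite -(laplacian_orthonormal mu_lie ip of_ oe) // lapH /rho.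
  by rewrite !(ricci_B_orthonormal mu_lie ip of_ oe _ _ H3).
(* The e_1, e_2, e_4 components of [d12] yield qs, qr, pq = 0 and its e_3 component yields [lam];
   [d14] and [d24] yield pr = 0 and ps = 0. *)
have d12 := dD (vec e 1) (vec e 2).
have d14 := dD (vec e 1) (vec e 4).
have d24 := dD (vec e 2) (vec e 4).
move: d12 d14 d24; rewrite !ricD' !vecE !(bracket_comb mu_lie fr).
rewrite !(ricci_B_comb mu_lie ip fr HE) !(combZ, combN, combD).
rewrite !(bracket_comb mu_lie fr) !combD.
move=> /(comb_inj e be)[c1 c2 c3 c4] /(comb_inj e be)[_ _ c5 _] /(comb_inj e be)[_ _ c6 _].
have l1 := lapH' (vec e 1) (vec e 2) (vec e 3).
have l2 := lapH' (vec e 1) (vec e 2) (vec e 4).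
have l3 := lapH' (vec e 1) (vec e 3) (vec e 4).
have l4 := lapH' (vec e 2) (vec e 3) (vec e 4).
move: l1 l2 l3 l4; rewrite /rho !vecE !(ricci_B_comb mu_lie ip fr HE).
rewrite !(laplacian_comb mu_lie ip fr HE) !(three_form_comb fr HE) /det3.
move=> l1 l2 l3 l4.
have ax0 x : a * x = 0 -> x = 0.
  by move/eqP; rewrite mulf_eq0 (negbTE a0) => /eqP.
(* The factor [k] absorbs the numerical coefficient between a given equation and the wanted one. *)
have from_eq (x y z k : R) : x = y -> z = k * (x - y) -> z = 0.
  by move=> -> ->; rewrite subrr mulr0.
have qs : q * s = 0 by apply: ax0; apply: (from_eq _ _ _ 2 c1); field.
have qr : q * r = 0 by apply: ax0; apply: (from_eq _ _ _ (-2) c2); field.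
have pq : p * q = 0 by apply: ax0; apply: (from_eq _ _ _ (-2) c4); field.
have pr : p * r = 0 by apply: ax0; apply: (from_eq _ _ _ (-2) c5); field.
have ps : p * s = 0 by apply: ax0; apply: (from_eq _ _ _ (-2) c6); field.
have lamE : lam = - (3 / 2 * a ^+ 2 + p ^+ 2 / 2 + q ^+ 2).
  apply/eqP; rewrite -subr_eq0; apply/eqP; apply: ax0.
  by apply: (from_eq _ _ _ 1 c3); field.
clear c1 c2 c3 c4 c5 c6.
have mul0 (x y : R) : x != 0 -> x * y = 0 -> y = 0.
  by move=> x0 /eqP; rewrite mulf_eq0 (negbTE x0) => /eqP.
have [p0|p0] := eqVneq p 0; last first.
  have q0 := mul0 _ _ p0 pq; have r0 := mul0 _ _ p0 pr.
  have s0 := mul0 _ _ p0 ps; left; split=> //.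
  apply/eqP; rewrite -subr_eq0; apply/eqP; apply: (mul0 p) => //.
  by apply: (from_eq _ _ _ (-1) l1); rewrite lamE q0 r0 s0; field.
have [q0|q0] := eqVneq q 0; last first.
  have r0 := mul0 _ _ q0 qr; have s0 := mul0 _ _ q0 qs.
  have /eqP : a ^+ 2 + q ^+ 2 = 0.
    apply: (mul0 q) => //.
    by apply: (from_eq _ _ _ (-2) l2); rewrite lamE p0 r0 s0; field.
  (* Both squares are nonnegative, so their sum can vanish only if [a] does. *)
  rewrite paddr_eq0 ?sqr_ge0 // !expf_eq0 /=.
  by rewrite (negbTE a0).
right; split=> //; apply/eqP; rewrite -subr_eq0; apply/eqP.
(* The last two equations are r and s times r^2 + s^2 - a^2, up to a constant; since [H] is nonzero,
   [r] or [s] can be cancelled. *)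
have [r0|r0] := eqVneq r 0; last first.
  apply: (mul0 r) => //.
  by apply: (from_eq _ _ _ (- 2 / 3) l3); rewrite lamE p0 q0; field.
have [s0|s0] := eqVneq s 0; last first.
  apply: (mul0 s) => //.
  by apply: (from_eq _ _ _ (- 2 / 3) l4); rewrite lamE p0 q0; field.
case: Hn0 => X Y Z; rewrite HE /form4 p0 q0 r0 s0; ring.
Qed.

(** Scaling by a^2 turns the two cases of [nilsoliton_components] into a coefficient p / a of square
    1, or a point (s / a, r / a) of the unit circle. *)
Lemma nilsoliton_classification H lam (D : 'End(V)) :
  generalized_nilsoliton mu g H lam D -> non_classical H ->
  exists (g' : V -> V -> R) (H' : V -> V -> V -> R) (lam' : R)
         (D' : 'End(V)) (e' : 4.-tuple V),
    [/\ generalized_equivalent mu g H g' H',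
        generalized_nilsoliton mu g' H' lam' D' &
        [\/ soliton1 mu g' H' lam' D' e',
            soliton1 mu g' (fun X Y Z => - H' X Y Z) lam' D' e' |
            exists l1 l2 : R, soliton2 mu g' H' lam' D' e' l1 l2]].
Proof.
move=> sol Hn0; have [[_ ip H3 _] _ _ _] := sol; have [[be _] _ _ _] := fr.
have [p [q [r [s HE]]]] := three_form_form4 e H be H3.
have a2 : 0 < a ^+ 2 by rewrite exprn_even_gt0.
have [e' [oe' ne' HE']] := unit_frame mu_lie ip fr a0.
have {}HE' := HE' H p q r s HE.
have ip' := inner_product_scale ip _ a2; have [be' _] := oe'.
pose v i := vec e' i.
have eqv := generalized_equivalent_scale (mu := mu) (g := g) H _ a2.
have [[pa [q0 r0 s0]]|[rs [p0 q0]]] := nilsoliton_components HE sol Hn0.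
- have eps2 : (p / a) ^+ 2 = 1 by rewrite expr_div_n pa divff // expf_neq0.
  have HE1 X Y Z : a ^+ 2 * H X Y Z = p / a * cov3 e' 1 2 3 X Y Z.
    by rewrite HE' q0 r0 s0 /form4 !mul0r !addr0.
  have [D' DE] := exists_endo e' (v 1) (v 2) (2 *: v 3) (2 *: v 4) be'.
  have [sol' _] := soliton1_nilsoliton mu_lie ip' oe' ne' eps2 HE1 DE.
  exists (fun X Y => a ^+ 2 * g X Y), (fun X Y Z => a ^+ 2 * H X Y Z), (-2), D', e'.
  split; [exact: eqv|exact: sol'|].
  (* The sign of [p / a] decides between e^123 and its negative. *)
  have /eqP := eps2; rewrite sqrf_eq1 => /orP[/eqP pa1|/eqP pa1].
    by apply: Or31; split=> // X Y Z; rewrite HE1 pa1 mul1r.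
  by apply: Or32; split=> // X Y Z; rewrite HE1 pa1 mulN1r opprK.
- pose l2 := r / a; pose l1 := s / a.
  have l12 : l1 ^+ 2 + l2 ^+ 2 = 1.
    by rewrite /l1 /l2 !expr_div_n -mulrDl addrC rs divff // expf_neq0.
  have [D' DE] := exists_endo e'
    ((1 - l2 ^+ 2 / 2) *: v 1 - (l1 * l2 / 2) *: v 2)
    ((1 - l1 ^+ 2 / 2) *: v 2 - (l1 * l2 / 2) *: v 1)
    ((3 / 2) *: v 3) (v 4) be'.
  have sol2 : soliton2 mu (fun X Y => a ^+ 2 * g X Y)
      (fun X Y Z => a ^+ 2 * H X Y Z) (- (3 / 2)) D' e' l1 l2.
    by split=> // X Y Z; rewrite HE' p0 q0 /form4 -/l1 -/l2; ring.
  have [sol' _] := soliton2_nilsoliton mu_lie ip' sol2.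
  exists (fun X Y => a ^+ 2 * g X Y), (fun X Y Z => a ^+ 2 * H X Y Z).
  exists (- (3 / 2)), D', e'; split; [exact: eqv|exact: sol'|].
  by apply: Or33; exists l1, l2.
Qed.

End Classification.

(** * Orthogonal complex structures and the SKT condition *)

Section Pluriclosed.
Context {R : realType} {V : vectType R} {mu : V -> V -> V}.
Context {g : V -> V -> R} {a : R} {e : 4.-tuple V}.
Context (mu_lie : lie_bracket mu) (ip : inner_product g).
Context (fr : heisenberg_frame mu g a e).

Let be : basis_of fullv e. Proof. by case: fr => -[]. Qed.

Section ComplexStructure.
Context {J : 'End(V)} {c d : R} (cc : c ^+ 2 = 1) (dd : d ^+ 2 = 1).
Context (JE : forall x1 x2 x3 x4, J (comb e x1 x2 x3 x4) =
  comb e (- (c * x2)) (c * x1) (- (d * x4)) (d * x3)).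

Lemma complex_structureK X : J (J X) = - X.
Proof.
have [x1 [x2 [x3 [x4 ->]]]] := combP e X be.
by rewrite !JE combN; congr (comb _ _ _ _ _); ring: cc dd.
Qed.

Lemma complex_structureV X : (J^-1)%VF X = - J X.
Proof.
have J0 : lker J == 0%VS.
  by apply/lker0P => x y /(congr1 J); rewrite !complex_structureK => /oppr_inj.
by have := lker0_lfunK J0 (- J X); rewrite linearN /= complex_structureK opprK.
Qed.

(** The signs [c] and [d] enter only through their squares, so all four complex structures give the
    same 3-form. *)
Lemma dc_omega_form4 X Y Z : dc_omega mu g J X Y Z = form4 e a 0 0 0 X Y Z.
Proof.
have [x1 [x2 [x3 [x4 ->]]]] := combP e X be.
have [y1 [y2 [y3 [y4 ->]]]] := combP e Y be.
have [z1 [z2 [z3 [z4 ->]]]] := combP e Z be.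
rewrite /dc_omega /dc2 /pull3 /d2 /pull2 /fundamental_form !complex_structureV.
rewrite !(JE, combN) !(bracket_comb mu_lie fr) !JE !(inner_comb ip fr).
by rewrite form4_comb // /det3; ring: cc dd.
Qed.

Lemma complex_structure_SKT : SKT mu g J.
Proof.
split=> //.
- split=> [|X Y]; first exact: complex_structureK.
  have [x1 [x2 [x3 [x4 ->]]]] := combP e X be.
  have [y1 [y2 [y3 [y4 ->]]]] := combP e Y be.
  rewrite !JE !(bracket_comb mu_lie fr) !(combN, combD) JE !(combN, combD).
  by rewrite (comb0 e); congr (comb _ _ _ _ _); ring: cc.
- move=> X Y; have [x1 [x2 [x3 [x4 ->]]]] := combP e X be.
  have [y1 [y2 [y3 [y4 ->]]]] := combP e Y be.
  by rewrite !JE !(inner_comb ip fr); ring: cc dd.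
- exact: (three_form_closed mu_lie fr dc_omega_form4).
Qed.

End ComplexStructure.

(** Integrability against the central vector e_3 puts J e_3 in span(e_3, e_4). Skewness and
    orthogonality then give J e_3 = +- e_4, and J rotates the orthogonal plane span(e_1, e_2). *)
Lemma orthogonal_complex_structure (J : 'End(V)) :
  a != 0 -> integrable_complex_structure mu J ->
  (forall X Y, g (J X) (J Y) = g X Y) ->
  exists c d, [/\ c ^+ 2 = 1, d ^+ 2 = 1 &
    forall x1 x2 x3 x4, J (comb e x1 x2 x3 x4) =
      comb e (- (c * x2)) (c * x1) (- (d * x4)) (d * x3)].
Proof.
move=> a0 [JJ NJ] Jo; have [bg _ _] := ip; have [_ _ m3 _] := fr.
have skew X Y : g (J X) Y = - g X (J Y).
  by rewrite -Jo JJ (bilinearNl bg).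
have sqr0 x : a * x ^+ 2 = 0 -> x = 0.
  by move/eqP; rewrite mulf_eq0 (negbTE a0) expf_eq0 => /eqP.
have [t1 [t2 [t3 [t4 J3]]]] := combP e (J (vec e 3)) be.
have [u1 [u2 [u3 [u4 J1]]]] := combP e (J (vec e 1)) be.
have [w1 [w2 [w3 [w4 J2]]]] := combP e (J (vec e 2)) be.
have J3Z k : J (comb e 0 0 k 0) = comb e (k * t1) (k * t2) (k * t3) (k * t4).
  by rewrite -combZ -J3 -linearZ vecE combZ !mulr0 mulr1.
have N1 := NJ (vec e 3) (vec e 1); have N2 := NJ (vec e 3) (vec e 2).
move: N1 N2; rewrite !m3 !addr0 !subr0 J1 J2 J3 !vecE !(bracket_comb mu_lie fr).
rewrite !J3Z !(combN, combD) (comb0 e) => /(comb_inj e be)[_ N1 _ _] /(comb_inj e be)[N2 _ _ _].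
(* Brackets lie along e_3, so the chosen components of the Nijenhuis tensor reduce, up to sign, to a
   t2^2 and a t1^2. *)
have t20 : t2 = 0 by apply: sqr0; rewrite -[RHS]N1; ring.
have t10 : t1 = 0 by apply: sqr0; rewrite -[RHS]oppr0 -[in RHS]N2; ring.
have sk i j := skew (vec e i) (vec e j).
have t30 : t3 = 0.
  by have := sk 3 3; rewrite J3 vecE !(inner_comb ip fr); lra.
have dd : t4 ^+ 2 = 1.
  have := Jo (vec e 3) (vec e 3); rewrite J3 vecE !(inner_comb ip fr) t10 t20 t30.
  by move=> h; rewrite -[RHS]mulr1 -[RHS]add0r; lra.
have J4 : J (vec e 4) = comb e 0 0 (- t4) 0.
  have J3' : J (vec e 3) = t4 *: vec e 4.
    by rewrite J3 t10 t20 t30 vecE combZ; congr (comb _ _ _ _ _); ring.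
  have := JJ (vec e 3); rewrite J3' linearZ /= => /(congr1 (fun X => t4 *: X)).
  rewrite scalerA -expr2 dd scale1r => ->.
  by rewrite vecE combN combZ; congr (comb _ _ _ _ _); ring.
have h11 := sk 1 1; have h13 := sk 1 3; have h14 := sk 1 4.
have h22 := sk 2 2; have h23 := sk 2 3; have h24 := sk 2 4.
have h12 := sk 1 2.
move: h11 h13 h14 h22 h23 h24 h12.
rewrite J1 J2 J3 J4 !vecE !(inner_comb ip fr) t10 t20 t30.
move=> h11 h13 h14 h22 h23 h24 h12.
have u10 : u1 = 0 by lra.
have u30 : u3 = 0 by lra.
have u40 : u4 = 0 by lra.
have w20 : w2 = 0 by lra.
have w30 : w3 = 0 by lra.
have w40 : w4 = 0 by lra.
have w1E : w1 = - u2 by lra.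
have cc : u2 ^+ 2 = 1.
  have := Jo (vec e 1) (vec e 1); rewrite J1 vecE !(inner_comb ip fr) u10 u30 u40.
  by move=> h; lra.
exists u2, t4; split=> // x1 x2 x3 x4.
rewrite (linear_comb e J (linearP J)) /= J1 J2 J3 J4 !(combZ, combD).
rewrite t10 t20 t30 u10 u30 u40 w20 w30 w40 w1E.
by congr (comb _ _ _ _ _); ring.
Qed.

End Pluriclosed.

(** * Existence and uniqueness of the pluriclosed soliton *)

Section PluriclosedSolitons.
Context {R : realType} {V : vectType R} {mu : V -> V -> V}.
Context (mu_lie : lie_bracket mu).

Lemma soliton1_pluriclosed g H lam (D : 'End(V)) e :
  inner_product g -> soliton1 mu g H lam D e -> is_pluriclosed_soliton mu g H.
Proof.
move=> ip [oe ne HD _ [D1 D2 D3 D4]].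
have [fr [be _]] := (n3R_basis_frame mu_lie oe ne, oe); have [bg _ _] := ip.
have [J [J1 J2 J3 J4]] :=
  exists_endo e (vec e 2) (- vec e 1) (vec e 4) (- vec e 3) be.
have JE x1 x2 x3 x4 : J (comb e x1 x2 x3 x4) =
    comb e (- (1 * x2)) (1 * x1) (- (1 * x4)) (1 * x3).
  rewrite (linear_comb e J (linearP J)) /= J1 J2 J3 J4 !vecE !(combN, combZ, combD).
  by congr (comb _ _ _ _ _); ring.
have DE x1 x2 x3 x4 : D (comb e x1 x2 x3 x4) = comb e x1 x2 (2 * x3) (2 * x4).
  rewrite (linear_comb e D (linearP D)) /= D1 D2 D3 D4 /comb !scalerA.
  by rewrite ![_ * 2]mulrC.
have one2 : 1 ^+ 2 = 1 :> R by rewrite expr1n.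
have dcE := dc_omega_form4 mu_lie ip fr one2 one2 JE.
exists J; split; last by move=> X Y Z; rewrite dcE HD /form4; ring.
split; first exact: (complex_structure_SKT mu_lie ip fr one2 one2 JE).
(* The Bismut connection is Levi-Civita plus half the torsion - e^123. Everything cancels except the
   rotation of the plane span(e_1, e_2) in the direction e_3. *)
pose nab X Y :=
  g X (vec e 3) *: (g Y (vec e 2) *: vec e 1 - g Y (vec e 1) *: vec e 2).
have nabE x1 x2 x3 x4 y1 y2 y3 y4 :
    nab (comb e x1 x2 x3 x4) (comb e y1 y2 y3 y4) =
    comb e (x3 * y2) (- (x3 * y1)) 0 0.
  rewrite /nab !vecE !(inner_comb ip fr) !(combZ, combN, combD).
  by congr (comb _ _ _ _ _); ring.
(* [D] is symmetric, hence its own transpose, and the endomorphism is -2 Id + D = diag(-1, -1, 0,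
   0). *)
exists nab, e, (-2 *: \1%VF + 2^-1 *: (D + D)), (-2), D, D; split=> //.
- split.
  + split=> [Y k X X'|X k Y Y'] /=;
      rewrite /nab !(bilinearDl bg) !(bilinearZl bg) /=.
      by rewrite scalerDl scalerA.
    rewrite !scalerDl !scalerA opprD addrACA scalerDr -!scalerA -scalerBr.
    by rewrite !scalerA mulrC.
  + move=> X Y Z; have [x1 [x2 [x3 [x4 ->]]]] := combP e X be.
    have [y1 [y2 [y3 [y4 ->]]]] := combP e Y be.
    have [z1 [z2 [z3 [z4 ->]]]] := combP e Z be.
    rewrite !nabE !(inner_comb ip fr); ring.
  + move=> X Y; have [x1 [x2 [x3 [x4 ->]]]] := combP e X be.
    have [y1 [y2 [y3 [y4 ->]]]] := combP e Y be.
    rewrite JE !nabE JE; congr (comb _ _ _ _ _); ring.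
  + apply: (eq_form4_three_form e (p := -1) (q := 0) (r := 0) (s := 0)) => // X Y Z.
    have [x1 [x2 [x3 [x4 ->]]]] := combP e X be.
    have [y1 [y2 [y3 [y4 ->]]]] := combP e Y be.
    have [z1 [z2 [z3 [z4 ->]]]] := combP e Z be.
    rewrite !nabE (bracket_comb mu_lie fr) !(combN, combD) (inner_comb ip fr).
    rewrite form4_comb // /det3; ring.
- move=> X Y; have [x1 [x2 [x3 [x4 ->]]]] := combP e X be.
  have [y1 [y2 [y3 [y4 ->]]]] := combP e Y be.
  rewrite /fundamental_form /part11 /pull2 /bismut_ricci !big_vec !vecE /curvature.
  rewrite !(add_lfunE, scale_lfunE, id_lfunE) !(DE, JE) !(combZ, combD, JE).
  rewrite !(bracket_comb mu_lie fr) !nabE !(combN, combD) !(inner_comb ip fr).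
  by field.
- split=> X; last first.
    have [x1 [x2 [x3 [x4 ->]]]] := combP e X be.
    rewrite !(JE, DE); congr (comb _ _ _ _ _); ring.
  move=> Y; have [x1 [x2 [x3 [x4 ->]]]] := combP e X be.
  have [y1 [y2 [y3 [y4 ->]]]] := combP e Y be.
  rewrite !(bracket_comb mu_lie fr, DE) combD; congr (comb _ _ _ _ _); ring.
- split=> // X Y; have [x1 [x2 [x3 [x4 ->]]]] := combP e X be.
  have [y1 [y2 [y3 [y4 ->]]]] := combP e Y be.
  rewrite !DE !(inner_comb ip fr); ring.
Qed.

(** The complex structure forces H = a e^123, and scaling by a^2 makes the coefficient a / a = 1, so
    the positive sign always results. *)
Lemma pluriclosed_classification g H : lie_isomorphic mu (@n3R_bracket R) ->
  is_pluriclosed_soliton mu g H ->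
  exists (g' : V -> V -> R) (H' : V -> V -> V -> R) (lam' : R)
         (D' : 'End(V)) (e : 4.-tuple V),
    generalized_equivalent mu g H g' H' /\ soliton1 mu g' H' lam' D' e.
Proof.
move=> iso [J [[[cJ ip Jo _] _] HJ]].
have [a [e [a0 fr]]] := heisenberg_frame_exists mu g mu_lie ip iso.
have [c [d [cc dd JE]]] := orthogonal_complex_structure mu_lie ip fr J a0 cJ Jo.
have HE X Y Z : H X Y Z = form4 e a 0 0 0 X Y Z.
  by rewrite HJ (dc_omega_form4 mu_lie ip fr cc dd JE).
have [e' [oe' ne' HE']] := unit_frame mu_lie ip fr a0; have [be' _] := oe'.
have a2 : 0 < a ^+ 2 by rewrite exprn_even_gt0.
have [D DE] :=
  exists_endo e' (vec e' 1) (vec e' 2) (2 *: vec e' 3) (2 *: vec e' 4) be'.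
(* Unification supplies the scaled metric and 3-form, the constant -2, [D] and [e']. *)
do 5!eexists; split; first exact: (generalized_equivalent_scale H _ a2).
split; [exact: oe'|exact: ne'| |reflexivity|exact: DE].
by move=> X Y Z; rewrite (HE' H a 0 0 0 HE) /form4 divff // !mul0r; ring.
Qed.

End PluriclosedSolitons.


Theorem proposition10p2 (R : realType) (V : vectType R) (mu : V -> V -> V)
    (mu_lie : lie_bracket mu) (mu_n3R : lie_isomorphic mu (@n3R_bracket R)) :
  [/\ (* every non-classical generalized nilsoliton is in the list *)
      forall (g : V -> V -> R) (H : V -> V -> V -> R) (lam : R) (D : 'End(V)),
        generalized_nilsoliton mu g H lam D -> non_classical H ->
        exists (g' : V -> V -> R) (H' : V -> V -> V -> R) (lam' : R)
               (D' : 'End(V)) (e : 4.-tuple V),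
          [/\ generalized_equivalent mu g H g' H',
              generalized_nilsoliton mu g' H' lam' D' &
              [\/ soliton1 mu g' H' lam' D' e,
                  (* H and - H are not related by scaling and automorphisms *)
                  soliton1 mu g' (fun X Y Z => - H' X Y Z) lam' D' e |
                  exists l1 l2 : R, soliton2 mu g' H' lam' D' e l1 l2]],
      (* every member of the list is a non-classical generalized nilsoliton *)
      forall (g : V -> V -> R) (H : V -> V -> V -> R) (lam : R) (D : 'End(V))
             (e : 4.-tuple V),
        inner_product g ->
        soliton1 mu g H lam D e \/
          (exists l1 l2 : R, soliton2 mu g H lam D e l1 l2) ->
        generalized_nilsoliton mu g H lam D /\ non_classical H,
      (* the first one is an algebraic pluriclosed soliton *)
      forall (g : V -> V -> R) (H : V -> V -> V -> R) (lam : R) (D : 'End(V))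
             (e : 4.-tuple V),
        inner_product g -> soliton1 mu g H lam D e ->
        is_pluriclosed_soliton mu g H &
      (* and it is the only one *)
      forall (g : V -> V -> R) (H : V -> V -> V -> R),
        is_pluriclosed_soliton mu g H ->
        exists (g' : V -> V -> R) (H' : V -> V -> V -> R) (lam' : R)
               (D' : 'End(V)) (e : 4.-tuple V),
          generalized_equivalent mu g H g' H' /\ soliton1 mu g' H' lam' D' e].
Proof.
split.
- move=> g H lam D sol; have [[_ ip _ _] _ _ _] := sol.
  have [a [e [a0 fr]]] := heisenberg_frame_exists mu g mu_lie ip mu_n3R.
  exact: nilsoliton_classification mu_lie fr a0 H lam D sol.
- move=> g H lam D e ip [[oe ne HE -> DE]|[l1 [l2 sol]]].
    (* The listed 3-form is the case of sign +1. *)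
    apply: (soliton1_nilsoliton mu_lie ip oe ne (expr1n R 2) _ DE) => X Y Z.
    by rewrite HE mul1r.
  by have := soliton2_nilsoliton mu_lie ip sol.

- exact: soliton1_pluriclosed mu_lie.
- by move=> g H; apply: pluriclosed_classification.
Qed.
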